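(* Let $G=(V,E)$ be a planar graph with $n$ vertices, let the vertices be ordered by a nested dissection ordering, and let $G'=(V,F)$ be the chordal extension of $G$ given by the sparsity pattern of the Cholesky factor for this ordering. Then every maximal clique of $G'$ has $O(\sqrt n)$ vertices. Moreover, for any real partial symmetric matrix $\bar X$ whose specified entries are exactly the diagonal entries and those in positions $F$, and which has a positive definite completion, $\ln\det\hat X$ can be computed in $O(n^{5/2})$ operations and $O(n\log n)$ space, where $\hat X$ is the maximum-determinant positive definite completion of $\bar X$. All constants in $O(\cdot)$ are absolute.
   Context: Separators: the vertices of a planar graph with $n'$ vertices can be partitioned into sets $A,B,C$ such that no edge joins $A$ to $B$, $|A|,|B|\le\frac23 n'$ and $|C|\le\sqrt{8n'}$. Nested dissection ordering (Lipton, Rose, Tarjan): a recursive numbering of the vertices. At a recursive call on a vertex set with $n'$ vertices, some of which may already be numbered: if $n'$ is less than a fixed constant ($72$), number the unnumbered vertices arbitrarily with the available numbers. Otherwise partition the $n'$ vertices into sets $A,B,C$ such that no edge of $G$ joins $A$ to $B$, $|A|,|B|\le\frac23 n'$ and $|C|\le\sqrt{8n'}$; number the unnumbered vertices of $C$ so that they are eliminated after all unnumbered vertices of $A$ and $B$ (that is, they receive the largest available numbers); then recursively number the unnumbered vertices in $A\cup C$ and in $B\cup C$. It is known that for $A,B,C$ at any level of the recursion no vertex of $A$ is adjacent in $G'$ to any vertex of $B$. Chordal extension: with vertices numbered $1,\ldots,n$ in elimination order, $F\supseteq E$ is obtained by processing $i=1,\ldots,n$ in order and, for each $i$, adding all edges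 between pairs of (current) neighbours of $i$ that have larger numbers. This is the off-diagonal nonzero pattern of the Cholesky factor of a positive definite matrix with pattern $E$, assuming no numerical cancellation. A partial symmetric matrix is a symmetric matrix in which only some of the entries are specified; a completion is a symmetric matrix agreeing with it on all specified entries. If $\bar X$ has a positive definite completion, there is a unique one, $\hat X$, maximizing the determinant among all positive definite completions. The cost model counts each exact real arithmetic operation, comparison, square root and logarithm as one operation, and each stored number as one unit of space. *)

(* Defs.v *)
From HB Require Import structures.
From mathcomp Require Import all_boot all_order all_algebra all_fingroup.
From mathcomp Require Import all_classical all_reals all_analysis.
Set Implicit Arguments.
Unset Strict Implicit.
Unset Printing Implicit Defensive.
Import Order.TTheory GRing.Theory Num.Theory.
Import numFieldNormedType.Exports.
Local Open Scope ring_scope.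

Definition simple_graph (V : finType) (e : rel V) : Prop :=
  symmetric e /\ irreflexive e.

(* Planarity as a drawing in the topological plane R * R. The arcs [g x y] and
   [g y x] of the same undirected edge need not be related. *)
Definition planar (R : realType) (V : finType) (e : rel V) : Prop :=
  exists (p : V -> R * R) (g : V -> V -> R -> R * R),
  [/\ injective p,
      (* each edge is a simple arc joining the points of its endpoints *)
      forall x y, e x y ->
        [/\ ({within `[0, 1], continuous (g x y)})%classic,
            {in `[0, 1] &, injective (g x y)},
            g x y 0 = p x & g x y 1 = p y],
      (* an arc meets vertices only at its two ends *)
      forall x y z t, e x y -> t \in `[0, 1] -> g x y t = p z ->
        t = 0 \/ t = 1 &
      (* arcs of distinct edges meet only at ends of both *)
      forall x y x' y' s t, e x y -> e x' y' -> [set x; y] != [set x'; y'] ->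
        s \in `[0, 1] -> t \in `[0, 1] -> g x y s = g x' y' t ->
        (s = 0 \/ s = 1) /\ (t = 0 \/ t = 1)].

Section Ordering.
Variables (n : nat) (e : rel 'I_n).

(* [num v] is the position of the vertex [v] in the elimination order, counted
   from 0. *)
Variable num : 'S_n.

(* [nd_call S N]: [num] is a possible outcome of the recursive call on the
   vertex set [S] when the vertices in [N] are already numbered. The
   inequalities |A|, |B| <= 2/3 |S| and |C| <= sqrt (8 |S|) are cleared of
   denominators and of the root. The set of numbers given to [S :\: N] being
   the set of available numbers, "[C :\: N] receives the largest available
   numbers" says that each of them exceeds all those given in [A] and [B]. *)
Inductive nd_call (S N : {set 'I_n}) : Prop :=
| nd_leaf of (#|S| < 72)%N
| nd_split (A B C : {set 'I_n}) of
    (72 <= #|S|)%N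
  & A :|: B :|: C = S
  & [&& [disjoint A & B], [disjoint A & C] & [disjoint B & C]]
  & {in A & B, forall x y, ~~ e x y}
  & (3 * #|A| <= 2 * #|S|)%N
  & (3 * #|B| <= 2 * #|S|)%N
  & (#|C| ^ 2 <= 8 * #|S|)%N
  & {in C :\: N & (A :|: B) :\: N, forall c v, (num v < num c)%N}
  & nd_call (A :|: C) (N :|: C)
  & nd_call (B :|: C) (N :|: C).

Definition nested_dissection : Prop := nd_call [set: 'I_n] finset.set0.

Definition eliminate (f : rel 'I_n) (v : 'I_n) : rel 'I_n := fun x y =>
  f x y || [&& x != y, f v x, f v y, (num v < num x)%N & (num v < num y)%N].

(* [(num^-1)%g i] is the vertex with number [i], and [enum 'I_n] is
   increasing. *)
Definition chordal_extension : rel 'I_n :=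
  foldl eliminate e [seq (num^-1)%g i | i <- enum 'I_n].

End Ordering.

Definition is_clique (V : finType) (f : rel V) (K : {set V}) : bool :=
  [forall x in K, forall y in K, (x != y) ==> f x y].

Definition maximal_clique (V : finType) (f : rel V) (K : {set V}) : bool :=
  maxset (is_clique f) K.

Section Completion.
Variables (R : realType) (n : nat).

Definition posdef (A : 'M[R]_n) : Prop :=
  A^T = A /\ forall v : 'cV[R]_n, v != 0 -> 0 < (v^T *m A *m v) 0 0.

(* Partial matrices have entries in [option R], [None] meaning unspecified. *)
Definition partial_symmetric (X : 'M[option R]_n) : Prop := X^T = X.

Definition specified_on (f : rel 'I_n) (X : 'M[option R]_n) : Prop :=
  forall i j, isSome (X i j) = (i == j) || f i j.

Definition completion (X : 'M[option R]_n) (Y : 'M[R]_n) : Prop :=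
  Y^T = Y /\ forall i j x, X i j = Some x -> Y i j = x.

Definition pd_completion (X : 'M[option R]_n) (Y : 'M[R]_n) : Prop :=
  completion X Y /\ posdef Y.

Definition maxdet_completion (X : 'M[option R]_n) (Y : 'M[R]_n) : Prop :=
  pd_completion X Y /\ forall Z, pd_completion X Z -> \det Z <= \det Y.

(* [l] lists, in any order, each specified entry (i, j, x) once; of the two
   symmetric positions (i, j) and (j, i) just one occurs. *)
Definition lists_entries (X : 'M[option R]_n) (l : seq ('I_n * 'I_n * R)) :
    Prop :=
  [/\ forall i j x, (i, j, x) \in l -> X i j = Some x,
      uniq [seq [set t.1.1; t.1.2] | t <- l] &
      forall i j x, X i j = Some x -> (i, j, x) \in l \/ (j, i, x) \in l].

End Completion.

(* A real RAM with two memories, one of natural numbers (used for indices) and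
   one of exact reals. Addresses are natural numbers computed at run time, and
   nothing converts a real into a natural number except through comparisons.
   Programs contain no real constants other than natural numbers. *)
Inductive iop := IAdd | ISub | IMul.

Inductive iexp :=
| INum of nat
| IGet of iexp
| IBin of iop & iexp & iexp.

Inductive rop := RAdd | RSub | RMul | RDiv.

Inductive rfun := RSqrt | RLn.

Inductive rexp :=
| ROfI of iexp
| RGet of iexp
| RBin of rop & rexp & rexp
| RFun of rfun & rexp.

Inductive test :=
| ILe of iexp & iexp
| RLe of rexp & rexp.

Inductive program :=
| Skip
| IPut of iexp & iexp
| RPut of iexp & rexp
| Seq of program & program
| If of test & program & program
| While of test & program.

(* [icells] and [rcells] are the least numbers of initial cells of the two
   memories containing all the cells accessed. *)
Record cost := Cost { ops : nat; icells : nat; rcells : nat }.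

Definition cost_add (k l : cost) : cost :=
  Cost (ops k + ops l) (maxn (icells k) (icells l))
       (maxn (rcells k) (rcells l)).

Definition one_op : cost := Cost 1 0 0.
Definition access_int (a : nat) : cost := Cost 1 a.+1 0.
Definition access_real (a : nat) : cost := Cost 1 0 a.+1.

Section Semantics.
Variable R : realType.

Record memory := Memory { imem : nat -> nat; rmem : nat -> R }.

(* Subtraction of natural numbers is truncated. *)
Definition iop_val (o : iop) : nat -> nat -> nat :=
  match o with IAdd => addn | ISub => subn | IMul => muln end.

(* The library's total functions are used: 1 / 0 = 0, and [Num.sqrt] and [ln]
   vanish at negative arguments (and [ln 0 = 0]). *)
Definition rop_val (o : rop) (x y : R) : R :=
  match o with
  | RAdd => x + y | RSub => x - y | RMul => x * y | RDiv => x / y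
  end.

Definition rfun_val (o : rfun) (x : R) : R :=
  match o with RSqrt => Num.sqrt x | RLn => ln x end.

Fixpoint ieval (M : memory) (a : iexp) : nat :=
  match a with
  | INum k => k
  | IGet b => imem M (ieval M b)
  | IBin o b c => iop_val o (ieval M b) (ieval M c)
  end.

Fixpoint reval (M : memory) (a : rexp) : R :=
  match a with
  | ROfI b => (ieval M b)%:R
  | RGet b => rmem M (ieval M b)
  | RBin o b c => rop_val o (reval M b) (reval M c)
  | RFun o b => rfun_val o (reval M b)
  end.

Definition teval (M : memory) (t : test) : bool :=
  match t with
  | ILe a b => (ieval M a <= ieval M b)%N
  | RLe a b => reval M a <= reval M b
  end.

(* Constants, memory accesses and index arithmetic are charged one operation
   each, just like arithmetic on reals. *)
Fixpoint icost (M : memory) (a : iexp) : cost :=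
  match a with
  | INum _ => one_op
  | IGet b => cost_add (icost M b) (access_int (ieval M b))
  | IBin _ b c => cost_add (cost_add (icost M b) (icost M c)) one_op
  end.

Fixpoint rcost (M : memory) (a : rexp) : cost :=
  match a with
  | ROfI b => cost_add (icost M b) one_op
  | RGet b => cost_add (icost M b) (access_real (ieval M b))
  | RBin _ b c => cost_add (cost_add (rcost M b) (rcost M c)) one_op
  | RFun _ b => cost_add (rcost M b) one_op
  end.

Definition tcost (M : memory) (t : test) : cost :=
  match t with
  | ILe a b => cost_add (cost_add (icost M a) (icost M b)) one_op
  | RLe a b => cost_add (cost_add (rcost M a) (rcost M b)) one_op
  end.

Definition iput (M : memory) (a v : nat) : memory :=
  Memory [eta imem M with a |-> v] (rmem M).

Definition rput (M : memory) (a : nat) (v : R) : memory :=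
  Memory (imem M) [eta rmem M with a |-> v].

(* [exec p M k M']: from memory [M], program [p] halts with memory [M'], at
   cost [k]. *)
Inductive exec : program -> memory -> cost -> memory -> Prop :=
| exec_skip M : exec Skip M one_op M
| exec_iput a b M :
    exec (IPut a b) M
      (cost_add (cost_add (icost M a) (icost M b)) (access_int (ieval M a)))
      (iput M (ieval M a) (ieval M b))
| exec_rput a b M :
    exec (RPut a b) M
      (cost_add (cost_add (icost M a) (rcost M b)) (access_real (ieval M a)))
      (rput M (ieval M a) (reval M b))
| exec_seq p q M k M' l M'' :
    exec p M k M' -> exec q M' l M'' -> exec (Seq p q) M (cost_add k l) M''
| exec_if t p q M k M' :
    exec (if teval M t then p else q) M k M' ->
    exec (If t p q) M (cost_add (tcost M t) k) M'
| exec_while_end t p M :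
    ~~ teval M t -> exec (While t p) M (tcost M t) M
| exec_while_step t p M k M' l M'' :
    teval M t -> exec p M k M' -> exec (While t p) M' l M'' ->
    exec (While t p) M (cost_add (tcost M t) (cost_add k l)) M''.

(* The input consists of the number of vertices, the number of listed entries,
   the number of each vertex in the elimination order, and the row indices,
   the column indices and the values of the listed entries. *)
Definition input_ints n (num : 'S_n) (l : seq ('I_n * 'I_n * R)) : seq nat :=
  [:: n; size l] ++ [seq nat_of_ord (num v) | v <- enum 'I_n]
    ++ [seq nat_of_ord t.1.1 | t <- l] ++ [seq nat_of_ord t.1.2 | t <- l].

Definition input_reals n (l : seq ('I_n * 'I_n * R)) : seq R :=
  [seq t.2 | t <- l].

(* All the cells that do not hold the input initially contain 0. *)
Definition input_memory n (num : 'S_n) (l : seq ('I_n * 'I_n * R)) : memory :=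
  Memory (nth 0%N (input_ints num l)) (nth 0 (input_reals l)).

(* The input counts as stored even if the program does not read it. *)
Definition space_used n (num : 'S_n) (l : seq ('I_n * 'I_n * R)) (k : cost) : nat :=
  maxn (size (input_ints num l)) (icells k)
    + maxn (size (input_reals l)) (rcells k).

End Semantics.

(* Main.v *)
(* Write K v for the neighbours of v in the chordal extension with larger
   numbers; v together with K v is a clique.

   Combinatorics. In a call on S with numbered vertices N, the extension has no
   edge from S \ N to the complement of S, so for v in the separator C the set
   K v lies in (S :&: N) :|: C. As the size of S shrinks by a constant factor
   per level, the separators met along a branch add up to O(sqrt n); summing
   |K v| over all calls gives O(n ln n) by induction on the call.

   Algebra. Let s v be the Schur complement at v of the specified clique
   matrix on v and K v, and let U be the unit triangular matrix whose columns
   are the corresponding solutions, (clique matrix) * (column v) = s v * e_v.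
   Then Xhat := U^-T diag(s) U^-1 is a completion. For any positive definite
   completion Z, the matrix U^T Z U has diagonal s and the determinant of Z, so
   Hadamard's inequality gives det Z <= prod s = det Xhat.

   Algorithm. ln det Xhat is the sum of the ln (s v), and s v is the last pivot
   of Gaussian elimination on the clique matrix with v put last: O(sqrt n ^ 3)
   operations for each v, after two scans of the O(n ln n) entries. *)

Require Import Defs.
From HB Require Import structures.
From mathcomp Require Import all_boot all_order all_algebra all_fingroup.
From mathcomp Require Import all_classical all_reals all_analysis.
From mathcomp Require Import ring lra zify.
Import Order.TTheory GRing.Theory Num.Theory.
Import numFieldNormedType.Exports.
Local Open Scope ring_scope.

Set Implicit Arguments.
Unset Strict Implicit.
Unset Printing Implicit Defensive.

(** * Chordal extension *)

(** The completion must be fixed before the entry list is given, while the program meets each clique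
    in the order of that list. Pivots are therefore characterised without any order, through a
    solution supported on the clique, and their uniqueness identifies the computed pivots with those
    that define the completion. Both are taken from an arbitrary positive definite completion [Y]:
    it supplies total matrices to eliminate in, but matters only through its entries on cliques,
    which are specified.

    The clique bound alone would give only O(n^(3/2)) edges. A separator vertex may be joined to all
    numbered vertices of its call, and a separator is handed down to both children, so the edge
    count needs a potential that charges numbered and unnumbered vertices differently.

    The program builds no adjacency lists. Rescanning every entry for every vertex costs O(n^2 ln
    n), which is below the n times (sqrt n)^3 spent on elimination. One matrix of O(n) cells is
    reused for all cliques, so the entry list dominates the space. *)

Section ChordalExtension.
Variables (n : nat) (e : rel 'I_n) (num : 'S_n).

Local Notation F := (chordal_extension e num).

Lemma chordal_extension_ind (P : rel 'I_n -> Prop) :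
  P e -> (forall f v, P f -> P (eliminate num f v)) -> P F.
Proof.
move=> Pe Pelim; rewrite /chordal_extension.
by elim: [seq _ | i <- _] e Pe => //= v s IHs f Pf; apply/IHs/Pelim.
Qed.

Lemma chordal_extension_sym : symmetric e -> symmetric F.
Proof.
move=> esym; apply: chordal_extension_ind => // f v fsym x y.
rewrite /eliminate fsym eq_sym; congr (_ || _).
by case: (y != x); case: (f v x); case: (f v y); rewrite //= andbC.
Qed.

(** Eliminating [w] only joins vertices numbered after [w], so the row of [v] is final as soon as
    all vertices still to come have larger numbers. *)
Lemma foldl_eliminate_later (s : seq 'I_n) (f : rel 'I_n) (v x : 'I_n) :
  all (fun w => num v < num w)%N s -> foldl (eliminate num) f s v x = f v x.
Proof.
elim: s f => //= w s IHs f /andP[vw /IHs ->]; rewrite /eliminate.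
by rewrite [(num w < num v)%N]ltnNge (ltnW vw) !(andbF, andFb) orbF.
Qed.

Lemma foldl_eliminate_sub (s : seq 'I_n) (f : rel 'I_n) (x y : 'I_n) :
  f x y -> foldl (eliminate num) f s x y.
Proof. by elim: s f => //= w s IHs f fxy; apply: IHs; rewrite /eliminate fxy. Qed.

Lemma elimination_order_split (v : 'I_n) : exists s1 s2,
  [seq (num^-1)%g i | i <- enum 'I_n] = s1 ++ v :: s2 /\
  all (fun w => num v < num w)%N s2.
Proof.
set s := map _ _.
have vs : v \in s by apply/mapP; exists (num v); rewrite ?mem_enum ?permK.
have srt : sorted (fun a b => num a < num b)%N s.
  suff: sorted ltn [seq nat_of_ord (num a) | a <- s] by rewrite sorted_map.
  rewrite /s -map_comp.
  rewrite (eq_map (_ : _ =1 val)); last by move=> i /=; rewrite permKV.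
  by rewrite val_enum_ord iota_ltn_sorted.
case/splitPr: vs srt => s1 s2 srt; exists s1, s2; split=> //.
have tr : transitive (fun a b => num a < num b)%N by move=> b a c; apply: ltn_trans.
move: srt; rewrite (sorted_pairwise tr) pairwise_cat /=.
by case/and4P.
Qed.

(** When [v] is eliminated its row is already that of the final graph, so this very step joins [x]
    and [y], and edges are never removed. *)
Lemma higher_nbrs_adj (v x y : 'I_n) :
  F v x -> F v y -> (num v < num x)%N -> (num v < num y)%N -> x != y -> F x y.
Proof.
move=> + + vx vy xy; rewrite /chordal_extension.
have [s1 [s2 [-> s2v]]] := elimination_order_split v.
rewrite !foldl_cat /=; set f := foldl _ e s1.
rewrite 2?(@foldl_eliminate_later _ _ v) // {1 2}/eliminate ltnn !andbF !orbF.
move=> fvx fvy; apply: foldl_eliminate_sub.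
by rewrite /eliminate fvx fvy vx vy xy orbT.
Qed.

Definition higher_nbrs (v : 'I_n) : {set 'I_n} :=
  [set w | F v w & (num v < num w)%N].

(** The witness is the lowest-numbered vertex of the clique; clique sizes thus reduce to sizes of
    [higher_nbrs]. *)
Lemma clique_sub_higher_nbrs (K : {set 'I_n}) : is_clique F K ->
  K != finset.set0 -> exists v, K \subset v |: higher_nbrs v.
Proof.
move=> Kcl /set0Pn[v0 v0K].
case: (@arg_minnP _ v0 (fun v => v \in K) (fun v => num v) v0K) => v vK vmin.
exists v; apply/fintype.subsetP => w wK; rewrite !inE.
case: eqVneq => //= wv; move/forall_inP/(_ v vK)/forall_inP/(_ w wK): Kcl.
rewrite eq_sym wv /= => -> /=; rewrite ltn_neqAle vmin // andbT.
by apply: contraNneq wv => /val_inj/perm_inj ->.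
Qed.

End ChordalExtension.

(** * Size of the fill *)

(** [283 / 100] is a rational slightly above the square root of 8. *)
Lemma nat_sqr_le_sqrt (R : realType) (c m : nat) :
  (c ^ 2 <= 8 * m)%N -> (c%:R : R) <= 283 / 100 * Num.sqrt m%:R.
Proof.
rewrite -(ler_nat R) natrX natrM => cm.
have r0 : 0 <= Num.sqrt m%:R :> R by apply: sqrtr_ge0.
have r2 : Num.sqrt m%:R ^+ 2 = m%:R :> R by rewrite sqr_sqrtr ?ler0n.
have r83 : 0 <= 283 / 100 * Num.sqrt m%:R :> R by lra.
rewrite -(@ler_pXn2r _ 2) // ?nnegrE ?ler0n //.
rewrite exprMn r2; apply: le_trans cm _.
by apply: ler_wpM2r; rewrite ?ler0n // expr2; lra.
Qed.

(** Once sqrt m >= 30 the ratio is at most 2/3 + 2.83/30 < 49/64. The target is the square of 7/8,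
    the factor by which square roots then shrink. *)
Lemma separated_part_size (R : realType) (m a c : nat) :
  (900 < m)%N -> (3 * a <= 2 * m)%N -> (c ^ 2 <= 8 * m)%N ->
  ((a + c)%:R : R) <= 49 / 64 * m%:R.
Proof.
move=> m900 am /(nat_sqr_le_sqrt R) cm.
have r0 : 0 <= Num.sqrt m%:R :> R by apply: sqrtr_ge0.
have r2 : Num.sqrt m%:R ^+ 2 = m%:R :> R by rewrite sqr_sqrtr ?ler0n.
have r30 : 30 <= Num.sqrt m%:R :> R.
  rewrite -(@ler_pXn2r _ 2) // ?nnegrE ?r2 -?natrX ?ler0n // ler_nat.
  exact: ltnW m900.
have am' : 3 * (a%:R : R) <= 2 * m%:R by rewrite -!natrM ler_nat.
rewrite natrD -r2 in am' *; nra.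
Qed.

Lemma separated_part_sqrt (R : realType) (m a c : nat) :
  (900 < m)%N -> (3 * a <= 2 * m)%N -> (c ^ 2 <= 8 * m)%N ->
  Num.sqrt (a + c)%:R <= 7 / 8 * Num.sqrt m%:R :> R.
Proof.
move=> m900 am cm; have := separated_part_size R m900 am cm.
move=> /(@ler_wsqrtr R) /le_trans; apply; rewrite sqrtrM //.
rewrite (_ : 49 / 64 = (7 / 8) ^+ 2) ?sqrtr_sqr ?ger0_norm //; last first.
  by rewrite expr2; field.
Qed.

Lemma separated_part_ln (R : realType) (m a c : nat) :
  (900 < m)%N -> (3 * a <= 2 * m)%N -> (c ^ 2 <= 8 * m)%N ->
  ln (a + c)%:R <= ln m%:R - 15 / 64 :> R.
Proof.
move=> m900 am cm; have sz := separated_part_size R m900 am cm.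
have m_gt : 900 < m%:R :> R by rewrite ltr_nat.
have ln_sub1 (x : R) : 0 < x -> ln x <= x - 1.
  by move=> x0; have := @le_ln1Dx R (x - 1); rewrite [1 + _]addrC subrK; apply; lra.
(* An empty part has [ln 0 = 0] by convention, so ln m >= 15/64 is needed there. Otherwise ln
   (49/64) <= 49/64 - 1 = -15/64. *)
have [->|ac0] := posnP (a + c)%N.
  rewrite ln0 // subr_ge0.
  have := ln_sub1 m%:R^-1; rewrite invr_gt0 lnV ?posrE; try lra.
  have : m%:R^-1 <= 1 / 2 :> R by rewrite ler_pdivlMr // ler_pdivrMl; lra.
  by move=> h /(_ ltac:(lra)); lra.
apply: (@le_trans _ _ (ln (49 / 64 * m%:R))).
  by rewrite ler_ln ?posrE ?ltr0n //; lra.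
rewrite lnM ?posrE; try lra.
by have := ln_sub1 (49 / 64) ltac:(lra); lra.
Qed.

Definition fill_bound (R : realType) (u l m : nat) : R :=
  10000 * u%:R * (1 + ln m%:R) + 40 * l%:R * Num.sqrt m%:R.

(** Balance of the constants. Terms in [l * r]: 40 * 7/8 from the children and 2.83 from [c * l],
    which leaves 2.17 out of 40. Terms in [r ^+ 2 = u + l]: 2.83^2 from [c * c] and 2 * 40 * 7/8 *
    2.83 from the separator entering both children, together less than 206.2. Their share in [u] is
    paid by the drop 10000 * 15/64 of the logarithmic term, and their share in [l] is below 2.07 *
    [l * r] because [100 <= r]. *)
Lemma fill_bound_arith (R : realFieldType)
    (cN c u1 u2 k1 k2 l u L L1 L2 r q1 q2 : R) :
  cN <= c -> u1 + u2 <= u -> k1 + k2 <= l ->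
  r ^+ 2 = u + l -> 100 <= r -> 0 <= L ->
  0 <= u -> 0 <= l -> 0 <= k2 -> 0 <= k1 -> 0 <= u2 -> 0 <= u1 -> 0 <= c ->
  L1 <= L - 15 / 64 -> L2 <= L - 15 / 64 ->
  q1 <= 7 / 8 * r -> q2 <= 7 / 8 * r -> c <= 283 / 100 * r ->
  cN * (l + c) + (10000 * u1 * (1 + L1) + 40 * (k1 + c) * q1)
    + (10000 * u2 * (1 + L2) + 40 * (k2 + c) * q2)
  <= 10000 * u * (1 + L) + 40 * l * r.
Proof.
move=> cNc u12 k12 r2 r100 L0 u0 l0 k20 k10 u20 u10 c0 hL1 hL2 hq1 hq2 hc.
have r0 : 0 <= r by lra.
have n1 : cN * (l + c) <= c * (l + c) by apply: ler_wpM2r => //; lra.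
have n2 : u1 * (1 + L1) <= u1 * (49 / 64 + L) by apply: ler_wpM2l => //; lra.
have n3 : u2 * (1 + L2) <= u2 * (49 / 64 + L) by apply: ler_wpM2l => //; lra.
have n4 : (u1 + u2) * (49 / 64 + L) <= u * (49 / 64 + L).
  by apply: ler_wpM2r => //; lra.
have n5 : (k1 + c) * q1 <= (k1 + c) * (7 / 8 * r) by apply: ler_wpM2l; lra.
have n6 : (k2 + c) * q2 <= (k2 + c) * (7 / 8 * r) by apply: ler_wpM2l; lra.
have n7 : (k1 + k2) * r <= l * r by apply: ler_wpM2r.
have n8 : c * l <= 283 / 100 * r * l by apply: ler_wpM2r.
have n9 : c * c <= 283 / 100 * r * (283 / 100 * r) by apply: ler_pM.
have n10 : c * r <= 283 / 100 * r * r by apply: ler_wpM2r.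
have n11 : 100 * l <= r * l by apply: ler_wpM2r.
rewrite expr2 in r2; lra.
Qed.

(* The weights [l * sqrt m] and [u * ln m] pay for the numbered and for the
   unnumbered vertices of a call: at a split the first shrinks by a constant
   factor, which covers [c * l], and the second by a multiple of [u]. *)
Lemma fill_bound_step (R : realType) (m u l a1 a2 c cN u1 u2 k1 k2 : nat) :
  (100 * 100 < m)%N -> m = (u + l)%N ->
  (3 * a1 <= 2 * m)%N -> (3 * a2 <= 2 * m)%N -> (c ^ 2 <= 8 * m)%N ->
  (cN <= c)%N -> (u1 + u2 <= u)%N -> (k1 + k2 <= l)%N ->
  (cN * (l + c))%:R + fill_bound R u1 (k1 + c) (a1 + c)
    + fill_bound R u2 (k2 + c) (a2 + c) <= fill_bound R u l m.
Proof.
move=> m_gt mE a1m a2m cm cNc u12 k12; rewrite /fill_bound.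
have m900 : (900 < m)%N by apply: leq_trans m_gt.
have := nat_sqr_le_sqrt R cm.
have := separated_part_sqrt R m900 a1m cm.
have := separated_part_sqrt R m900 a2m cm.
have := separated_part_ln R m900 a1m cm.
have := separated_part_ln R m900 a2m cm.
have r0 : 0 <= Num.sqrt m%:R :> R by apply: sqrtr_ge0.
have r2 : Num.sqrt m%:R ^+ 2 = m%:R :> R by rewrite sqr_sqrtr ?ler0n.
have r100 : 100 <= Num.sqrt m%:R :> R.
  rewrite -(@ler_pXn2r _ 2) // ?nnegrE ?r2 -?natrX ?ler0n // ler_nat.
  exact: ltnW.
have L0 : 0 <= ln m%:R :> R by apply: ln_ge0; rewrite ler1n; apply: leq_trans m900.
have mER : m%:R = u%:R + l%:R :> R by rewrite mE natrD.
have {}cNc : cN%:R <= c%:R :> R by rewrite ler_nat.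
have {}u12 : u1%:R + u2%:R <= u%:R :> R by rewrite -natrD ler_nat.
have {}k12 : k1%:R + k2%:R <= l%:R :> R by rewrite -natrD ler_nat.
rewrite natrM [(l + c)%:R]natrD [(k1 + c)%:R]natrD [(k2 + c)%:R]natrD.
have := ler0n R cN; have := ler0n R c; have := ler0n R u1; have := ler0n R u2.
have := ler0n R k1; have := ler0n R k2; have := ler0n R l; have := ler0n R u.
rewrite [RHS]mER in r2.
by move=> *; apply: fill_bound_arith.
Qed.

(** * Higher neighbourhoods along the recursive calls *)

Section NestedDissection.
Variables (R : realType) (n : nat) (e : rel 'I_n) (num : 'S_n).
Hypothesis esym : symmetric e.

Local Notation F := (chordal_extension e num).
Local Notation K := (higher_nbrs e num).

(** The first clause speaks of [e], the relation that a split controls; the second is what lets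
    [nd_inv_nbrs] carry it over to the extension. *)
Definition nd_inv (S N : {set 'I_n}) : Prop :=
  (forall x y, x \in S :\: N -> e x y -> y \in S) /\
  {in S :\: N & S :&: N, forall x y, (num x < num y)%N}.

Lemma nd_inv_nbrs (S N : {set 'I_n}) (x y : 'I_n) :
  nd_inv S N -> x \in S :\: N -> F x y -> y \in S.
Proof.
case=> eS numS; pose P (f : rel 'I_n) :=
  symmetric f /\ forall x y, x \in S :\: N -> f x y -> y \in S.
have [_] : P F; last by move=> h xS; apply: h.
apply: chordal_extension_ind => // f v [fsym fS]; split=> [a b|a b aS].
  rewrite /eliminate fsym eq_sym; congr (_ || _).
  by case: (b != a); case: (f v a); case: (f v b); rewrite //= andbC.
(* For a fill edge at [a] created by [v]: as a neighbour of [a], [v] lies in [S]; being numbered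
   before [a], it is not in [N]; hence its neighbour [b] lies in [S] as well. *)
case/orP=> [/(fS _ _ aS)//|/and5P[_ fva fvb va vb]].
have vS : v \in S by apply: (fS a) => //; rewrite fsym.
apply: (fS v) fvb; rewrite !inE vS andbT.
apply/negP => vN; have := numS a v aS; rewrite inE vS vN => /(_ isT).
by rewrite ltnNge ltnW.
Qed.

Lemma higher_nbrs_sub (S N : {set 'I_n}) (x : 'I_n) :
  nd_inv S N -> x \in S :\: N -> K x \subset S.
Proof.
move=> SN xS; apply/fintype.subsetP => y; rewrite inE => /andP[Fxy _].
exact: nd_inv_nbrs SN xS Fxy.
Qed.

(** Neighbours of [A :\: N] stay in [S] and miss [B]. A vertex of [C] comes after [A :\: N] by the
    old invariant if it was in [N], and by the split otherwise. The call on [B] is obtained by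
    exchanging [A] and [B]. *)
Lemma nd_inv_child (A B C N : {set 'I_n}) :
  [&& [disjoint A & B], [disjoint A & C] & [disjoint B & C]] ->
  {in A & B, forall x y, ~~ e x y} ->
  {in C :\: N & (A :|: B) :\: N, forall c v, (num v < num c)%N} ->
  nd_inv (A :|: B :|: C) N -> nd_inv (A :|: C) (N :|: C).
Proof.
move=> /and3P[dAB dAC dBC] AB CN [eS numS].
have inA x : x \in (A :|: C) :\: (N :|: C) -> [/\ x \in A & x \notin N].
  by rewrite !inE negb_or; case: (x \in A); case: (x \in N); case: (x \in C).
split=> [x y /inA[xA xN] exy | x y /inA[xA xN]].
  have := eS x y; rewrite !inE xA xN => /(_ isT exy).
  have [yB|] := boolP (y \in B); first by have := AB _ _ xA yB; rewrite exy.
  by rewrite orbF.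
have [yC _|yC] := boolP (y \in C).
  have [yN|yN] := boolP (y \in N).
    by apply: numS; rewrite !inE ?xA ?yC ?yN ?xN ?orbT.
  by apply: CN; rewrite !inE ?xA ?yC ?yN ?xN.
rewrite !inE (negPf yC) !orbF => /andP[yA yN].
by apply: numS; rewrite !inE ?xA ?yA ?yN ?xN.
Qed.

Lemma separator_higher_nbrs (A B C N : {set 'I_n}) (v : 'I_n) :
  {in C :\: N & (A :|: B) :\: N, forall c v, (num v < num c)%N} ->
  nd_inv (A :|: B :|: C) N -> v \in C :\: N ->
  (#|K v| <= #|(A :|: B :|: C) :&: N| + #|C|)%N.
Proof.
move=> CN SN vC.
have vS : v \in (A :|: B :|: C) :\: N.
  by move: vC; rewrite !inE => /andP[-> ->]; rewrite orbT.
apply: leq_trans (leq_card_setU _ _); apply: subset_leq_card.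
apply/fintype.subsetP => y yK; move/fintype.subsetP/(_ y yK): (higher_nbrs_sub SN vS).
move: yK; rewrite !inE => /andP[_ vy].
have [yN|yN] := boolP (y \in N); first by move=> ->.
have [yC|yC] := boolP (y \in C); first by rewrite !orbT.
rewrite orbF => yAB; have := CN v y vC; rewrite !inE yN yAB => /(_ isT).
by rewrite ltnNge (ltnW vy).
Qed.

Lemma child_unnumbered (A C N : {set 'I_n}) : [disjoint A & C] ->
  (A :|: C) :\: (N :|: C) = A :\: N.
Proof.
move=> dAC; apply/setP => x; rewrite !inE negb_or.
have [xC|] := boolP (x \in C); last by rewrite !orbF andbT.
by rewrite (disjointFl dAC xC) !andbF.
Qed.

Lemma child_numbered (A C N : {set 'I_n}) : [disjoint A & C] ->
  #|(A :|: C) :&: (N :|: C)| = (#|A :&: N| + #|C|)%N.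
Proof.
move=> dAC; rewrite -finset.setUIl cardsU [X in (_ - X)%N]eq_card0 ?subn0 // => x.
by rewrite !inE; case: (boolP (x \in A)) => // /(disjointFr dAC) ->; rewrite andbF.
Qed.

(** The constant 30 meets two requirements: the trivial bound [#|S|] suffices up to size 30^2, and
    in a child the gain of 30/8 times sqrt [#|S|] pays for [C], at most 2.83 times sqrt [#|S|],
    joining the numbered part. *)
Lemma higher_nbrs_bound (S N : {set 'I_n}) :
  nd_call e num S N -> nd_inv S N ->
  forall v, v \in S :\: N ->
  #|K v|%:R <= #|S :&: N|%:R + 30 * Num.sqrt #|S|%:R :> R.
Proof.
have small (S' N' : {set 'I_n}) v : (#|S'| <= 900)%N -> nd_inv S' N' ->
    v \in S' :\: N' ->
    #|K v|%:R <= #|S' :&: N'|%:R + 30 * Num.sqrt #|S'|%:R :> R.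
  move=> S900 SN vS; apply: (@le_trans _ _ (#|S'|%:R : R)).
    by rewrite ler_nat; apply/subset_leq_card/(higher_nbrs_sub SN).
  have r0 : 0 <= Num.sqrt #|S'|%:R :> R by apply: sqrtr_ge0.
  have r2 : Num.sqrt #|S'|%:R ^+ 2 = #|S'|%:R :> R by rewrite sqr_sqrtr ?ler0n.
  have r30 : Num.sqrt #|S'|%:R <= 30 :> R.
    rewrite -(@ler_pXn2r _ 2) // ?nnegrE ?r2 -?natrX ?ler0n // ler_nat //.
  have l0 := ler0n R #|S' :&: N'|.
  by rewrite -[X in X <= _]r2 expr2; nra.
elim/nd_call_ind => {}S {}N => [S72|A B C S72 SE dABC AB a23 b23 c8 CN _ IHA _ IHB].
  by move=> SN v vS; apply: small => //; apply: leq_trans (ltnW S72) _.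
move=> SN v vS; have [|S900] := leqP #|S| 900; first by move/small; apply.
have child (A' : {set 'I_n}) : A' \subset S -> [disjoint A' & C] ->
    (3 * #|A'| <= 2 * #|S|)%N ->
    (#|K v|%:R <= #|(A' :|: C) :&: (N :|: C)|%:R
       + 30 * Num.sqrt #|A' :|: C|%:R :> R) ->
    #|K v|%:R <= #|S :&: N|%:R + 30 * Num.sqrt #|S|%:R :> R.
  move=> A'S dA'C a'23; rewrite child_numbered // cardsU.
  have -> : #|A' :&: C| = 0%N by apply/eqP; rewrite cards_eq0 setI_eq0.
  have : (#|A' :&: N| <= #|S :&: N|)%N by apply/subset_leq_card/finset.setSI.
  rewrite subn0 -(ler_nat R) natrD.
  have := separated_part_sqrt R S900 a'23 c8; have := nat_sqr_le_sqrt R c8.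
  have : 0 <= Num.sqrt #|S|%:R :> R by apply: sqrtr_ge0.
  lra.
have [dAB dAC dBC] := and3P dABC.
rewrite -SE in SN; have [vC|vC] := boolP (v \in C).
  have vCN : v \in C :\: N by move: vS; rewrite !inE vC => /andP[->].
  have := separator_higher_nbrs CN SN vCN; rewrite SE -(ler_nat R) natrD.
  have := nat_sqr_le_sqrt R c8.
  have : 0 <= Num.sqrt #|S|%:R :> R by apply: sqrtr_ge0.
  lra.
move: vS; rewrite -{1}SE !inE (negPf vC) orbF => /andP[vN /orP[vA|vB]].
- apply: (child A) => //; first by rewrite -SE -finset.setUA finset.subsetUl.
  apply: IHA; first exact: nd_inv_child SN.
  by rewrite child_unnumbered // !inE vA vN.
- apply: (child B) => //.
    by rewrite -SE [A :|: B]finset.setUC -finset.setUA finset.subsetUl.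
  apply: IHB; last by rewrite child_unnumbered // !inE vB vN.
  rewrite [A :|: B]finset.setUC in SN CN.
  apply: nd_inv_child SN => //; first by rewrite disjoint_sym dAB dBC.
  by move=> x y xB yA; rewrite esym; apply: AB.
Qed.

(** Up to size 100 * 100 the trivial bound of [#|S|] neighbours per unnumbered vertex fits into the
    term with factor 10000; beyond that size [fill_bound_step] applies. *)
Lemma fill_bound_nd_call (S N : {set 'I_n}) :
  nd_call e num S N -> nd_inv S N ->
  (\sum_(v in S :\: N) #|K v|)%:R
    <= fill_bound R #|S :\: N| #|S :&: N| #|S|.
Proof.
have small (S' N' : {set 'I_n}) : (#|S'| <= 100 * 100)%N -> nd_inv S' N' ->
    (\sum_(v in S' :\: N') #|K v|)%:R
      <= fill_bound R #|S' :\: N'| #|S' :&: N'| #|S'|.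
  move=> S1 SN; rewrite /fill_bound.
  have le1 : (\sum_(v in S' :\: N') #|K v| <= #|S' :\: N'| * #|S'|)%N.
    rewrite -sum_nat_const; apply: leq_sum => v vS.
    exact/subset_leq_card/(higher_nbrs_sub SN).
  have [S0|S0] := posnP #|S'|.
    move: le1; rewrite S0 muln0 leqn0 => /eqP ->; rewrite ln0 //.
    rewrite sqrtr0 mulr0 addr0; have := ler0n R #|S' :\: N'|; lra.
  have L0 : 0 <= ln #|S'|%:R :> R by apply: ln_ge0; rewrite ler1n.
  have r0 : 0 <= Num.sqrt #|S'|%:R :> R by apply: sqrtr_ge0.
  apply: (@le_trans _ _ ((#|S' :\: N'| * #|S'|)%:R)); first by rewrite ler_nat.
  rewrite natrM.
  have l0 : 0 <= #|S' :&: N'|%:R * Num.sqrt #|S'|%:R :> R.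
    by rewrite mulr_ge0 ?ler0n.
  have u0 : 0 <= #|S' :\: N'|%:R * ln #|S'|%:R :> R by rewrite mulr_ge0 ?ler0n.
  have : #|S'|%:R <= 100 * 100 :> R by rewrite -natrM ler_nat.
  move/(ler_wpM2l (ler0n R #|S' :\: N'|)); lra.
elim/nd_call_ind => {}S {}N => [S72|A B C S72 SE dABC AB a23 b23 c8 CN _ IHA _ IHB].
  by move=> SN; apply: small => //; apply: leq_trans (ltnW S72) _.
move=> SN; have [|Sbig] := leqP #|S| (100 * 100); first by move/small; apply.
rewrite -{1}SE in SN.
have [dAB dAC dBC] := and3P dABC.
have dABr : [disjoint B & A] by rewrite disjoint_sym.
have IA : nd_inv (A :|: C) (N :|: C) by apply: nd_inv_child SN.
have IB : nd_inv (B :|: C) (N :|: C).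
  rewrite [A :|: B]finset.setUC in SN CN.
  apply: nd_inv_child SN => //; first by rewrite dABr dBC.
  by move=> x y xB yA; rewrite esym; apply: AB.
move: {IHA IHB} (IHA IA) (IHB IB); rewrite !child_unnumbered // !child_numbered //.
rewrite !cardsU.
have -> : #|A :&: C| = 0%N by apply/eqP; rewrite cards_eq0 setI_eq0.
have -> : #|B :&: C| = 0%N by apply/eqP; rewrite cards_eq0 setI_eq0.
rewrite !subn0 => IHA IHB.
have SNE : S :\: N = (C :\: N) :|: ((A :\: N) :|: (B :\: N)).
  by rewrite -SE !finset.setDUl finset.setUC.
have dAB' : [disjoint A :\: N & B :\: N].
  apply: disjointWl (finset.subsetDl _ _) _.
  by apply: disjointWr (finset.subsetDl _ _) _.
have dC' : [disjoint C :\: N & (A :\: N) :|: (B :\: N)].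
  rewrite -finset.setDUl; apply: disjointWl (finset.subsetDl _ _) _.
  apply: disjointWr (finset.subsetDl _ _) _.
  by rewrite disjoint_sym -setI_eq0 finset.setIUl finset.setU_eq0 !setI_eq0 dAC.
have uE : (#|A :\: N| + #|B :\: N| <= #|S :\: N|)%N.
  rewrite SNE [X in (_ <= X)%N]cardsU disjoint_setI0 // finset.cards0 subn0.
  rewrite [#|(A :\: N) :|: _|]cardsU disjoint_setI0 // finset.cards0 subn0.
  exact: leq_addl.
have lE : (#|A :&: N| + #|B :&: N| <= #|S :&: N|)%N.
  have <- : #|(A :|: B) :&: N| = (#|A :&: N| + #|B :&: N|)%N.
    rewrite finset.setIUl cardsU [X in (_ - X)%N](_ : _ = 0%N) ?subn0 //.
    apply/eqP; rewrite cards_eq0 setI_eq0.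
    apply: disjointWl (finset.subsetIl _ _) _.
    by apply: disjointWr (finset.subsetIl _ _) _.
  by apply/subset_leq_card/finset.setSI; rewrite -SE finset.subsetUl.
have mE : #|S| = (#|S :\: N| + #|S :&: N|)%N by rewrite addnC cardsID.
have cE : (#|C :\: N| <= #|C|)%N by apply/subset_leq_card/finset.subsetDl.
apply: le_trans (fill_bound_step R Sbig mE a23 b23 c8 cE uE lE).
have sumU (X Y : {set 'I_n}) : [disjoint X & Y] ->
    (\sum_(v in X :|: Y) #|K v| = \sum_(v in X) #|K v| + \sum_(v in Y) #|K v|)%N.
  by move=> XY; rewrite -bigU //; apply: eq_bigl => v; rewrite !inE.
rewrite SNE sumU // sumU // !natrD addrA.
(* What remains is the term [cN * (l + c)]: each unnumbered separator vertex has at most [l + c]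
   higher neighbours. *)
apply: lerD IHB; apply: lerD IHA; rewrite ler_nat -sum_nat_const.
apply: leq_sum => v vC; have := separator_higher_nbrs CN SN vC.
by rewrite SE.
Qed.

Lemma higher_nbrs_sqrt (v : 'I_n) : nested_dissection e num ->
  #|K v|%:R <= 30 * Num.sqrt n%:R :> R.
Proof.
move=> nd; have := @higher_nbrs_bound [set: 'I_n] finset.set0 nd.
rewrite finset.setI0 finset.cards0 add0r cardsT card_ord; apply.
  by split=> [x y|x y]; rewrite !inE.
by rewrite !inE.
Qed.

Lemma fill_n_log_n : nested_dissection e num ->
  (\sum_v #|K v|)%:R <= 10000 * n%:R * (1 + ln n%:R) :> R.
Proof.
move=> nd; have := @fill_bound_nd_call [set: 'I_n] finset.set0 nd.
rewrite finset.setI0 finset.cards0 finset.setD0 cardsT card_ord.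
rewrite /fill_bound mulr0 mul0r addr0 (eq_bigl xpredT); last by move=> v; rewrite inE.
apply; by split=> [x y|x y]; rewrite !inE.
Qed.

End NestedDissection.

(** * Maximum-determinant completion *)

Section PositiveDefinite.
Variable R : realType.

Lemma posdef_congr n (A U : 'M[R]_n) :
  posdef A -> U \in unitmx -> posdef (U^T *m A *m U).
Proof.
move=> [As Ap] Uu; split; first by rewrite !trmx_mul trmxK As mulmxA.
move=> v v0; have Uv0 : U *m v != 0.
  by apply: contraNneq v0 => Uv; rewrite -(mulKmx Uu v) Uv mulmx0.
by have := Ap _ Uv0; rewrite trmx_mul !mulmxA.
Qed.

Lemma quad_formE n (A : 'M[R]_n) (v : 'cV[R]_n) :
  (v^T *m A *m v) 0 0 = \sum_i v i 0 * \sum_j A i j * v j 0.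
Proof.
rewrite -mulmxA mxE; apply: eq_bigr => i _; rewrite !mxE.
by congr (_ * _).
Qed.

Lemma posdef_diag_gt0 n (A : 'M[R]_n) i : posdef A -> 0 < A i i.
Proof.
move=> [_ /(_ (delta_mx i 0))]; rewrite trmx_delta -rowE -colE !mxE; apply.
apply/negP => /eqP/matrixP/(_ i 0); rewrite !mxE !eqxx /=.
by apply/eqP; rewrite oner_eq0.
Qed.

Lemma trmxZ m n (a : R) (A : 'M[R]_(m, n)) : (a *: A)^T = a *: A^T.
Proof. by apply/matrixP => i j; rewrite !mxE. Qed.

(** Clearing the first row and column by a congruence of determinant 1 leaves a positive definite
    Schur complement, whose diagonal entries are those of [A] lowered by the nonnegative squares of
    the entries of [b] over [A 0 0]. *)
Lemma hadamard_inequality n (A : 'M[R]_n) : posdef A -> \det A <= \prod_i A i i.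
Proof.
elim: n A => [A _|n IHn]; first by rewrite det_mx00 big_ord0.
rewrite -[n.+1]/(1 + n)%N => A Ap.
have a0 : 0 < A 0 0 by apply: posdef_diag_gt0.
pose b := ursubmx A; pose C := drsubmx A.
have AE : A = block_mx (A 0 0)%:M b b^T C.
  rewrite -[LHS]submxK; congr block_mx; last first.
    by apply/matrixP => i j; rewrite !mxE -[in LHS](proj1 Ap) mxE.
  by apply/matrixP => i j; rewrite !ord1 !mxE eqxx; congr (A _ _); apply: val_inj.
pose U : 'M[R]_(1 + n) := block_mx 1%:M ((- (A 0 0)^-1) *: b) 0 1%:M.
have detU : \det U = 1 by rewrite det_ublock !det1 mulr1.
pose C' := C - (A 0 0)^-1 *: (b^T *m b).
have UAU : U^T *m A *m U = block_mx (A 0 0)%:M 0 0 C'.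
  rewrite [in LHS]AE tr_block_mx !mulmx_block !trmx1 trmx0.
  rewrite !(mul1mx, mulmx1, mul0mx, mulmx0, addr0, add0r, mul_scalar_mx, mul_mx_scalar).
  rewrite trmxZ !scalerA mulrN mulfV ?gt_eqF // !scaleN1r !addNr.
  by rewrite mul0mx add0r -scalemxAl scaleNr addrC.
have /(posdef_congr Ap) : U \in unitmx by rewrite unitmxE detU unitr1.
rewrite UAU => -[Bs Bp].
have C'p : posdef C'.
  split.
    by move/(congr1 drsubmx): Bs; rewrite tr_block_mx !block_mxKdr.
  move=> v v0; have := Bp (col_mx 0 v).
  rewrite tr_col_mx mul_row_block mul_row_col !(mulmx0, addr0, trmx0, mul0mx, add0r).
  apply; apply: contraNneq v0 => h.
  by move/(congr1 dsubmx): h; rewrite col_mxKd linear0 => ->.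
have detA : \det A = A 0 0 * \det C'.
  have := congr1 determinant UAU.
  by rewrite !det_mulmx det_tr detU mul1r mulr1 det_ublock det_scalar1.
rewrite detA big_split_ord /= big_ord1.
have -> : lshift n 0 = 0 :> 'I_(1 + n) by apply: val_inj.
rewrite ler_pM2l //; apply: le_trans (IHn _ C'p) _.
apply: ler_prod => i _; rewrite ltW ?posdef_diag_gt0 //=.
have -> : A (rshift 1 i) (rshift 1 i) = C i i by rewrite !mxE.
have -> : C' i i = C i i - (A 0 0)^-1 * (b^T *m b) i i by rewrite !mxE.
rewrite lerBlDr lerDl mulr_ge0 ?invr_ge0 ?(ltW a0) //.
by rewrite mxE big_ord1 mxE -expr2 sqr_ge0.
Qed.

End PositiveDefinite.

(* [s] is the Schur complement at [v] of the principal submatrix of [Y] on [S],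
   and [c] is the column of the triangular factor that exhibits it. *)
Definition schur_pivot (R : realType) n (Y : 'M[R]_n) (S : {set 'I_n}) (v : 'I_n)
    (s : R) (c : 'I_n -> R) : Prop :=
  [/\ v \in S, c v = 1, forall w, w \notin S -> c w = 0 &
      forall w, w \in S -> \sum_t Y w t * c t = if w == v then s else 0].

Lemma schur_pivot_form (R : realType) n (Y : 'M[R]_n) (S : {set 'I_n}) v s c c' :
  schur_pivot Y S v s c -> c' v = 1 -> (forall w, w \notin S -> c' w = 0) ->
  \sum_w c' w * \sum_t Y w t * c t = s.
Proof.
move=> [vS cv cS Yc] c'v c'S; rewrite (bigD1 v) //= Yc // eqxx c'v mul1r.
rewrite big1 ?addr0 // => w /negPf wv.
by have [wS|/c'S ->] := boolP (w \in S); rewrite ?mul0r // Yc // wv mulr0.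
Qed.

(** By symmetry both pivots are the value of the bilinear form of [Y] at the two solutions. This
    identifies pivots found by eliminating one clique in different orders. *)
Lemma schur_pivot_uniq (R : realType) n (Y : 'M[R]_n) (S : {set 'I_n}) v s s' c c' :
  Y^T = Y -> schur_pivot Y S v s c -> schur_pivot Y S v s' c' -> s = s'.
Proof.
move=> Ysym sc s'c'; have [_ cv cS _] := sc; have [_ c'v c'S _] := s'c'.
rewrite -(schur_pivot_form sc c'v c'S) -(schur_pivot_form s'c' cv cS).
under eq_bigr do rewrite mulr_sumr.
under [RHS]eq_bigr do rewrite mulr_sumr.
rewrite exchange_big; apply: eq_bigr => t _; apply: eq_bigr => w _.
by rewrite -[in LHS]Ysym mxE; ring.
Qed.

(** * The completion defined by the pivots, its optimality and its agreement with the data *)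

Section MaxDet.
Variables (R : realType) (n : nat) (e : rel 'I_n) (num : 'S_n).
Hypothesis esym : symmetric e.

Local Notation F := (chordal_extension e num).
Local Notation K := (higher_nbrs e num).

Variables (Y : 'M[R]_n) (s : 'I_n -> R) (c : 'I_n -> 'I_n -> R).
Hypothesis Ypd : posdef Y.
Hypothesis Yc : forall v, schur_pivot Y (v |: K v) v (s v) (c v).

Let U : 'M[R]_n := \matrix_(w, v) c v w.
Let D : 'M[R]_n := diag_mx (\row_v s v).

Lemma pivot_factor_diag v : U v v = 1.
Proof. by rewrite mxE; case: (Yc v). Qed.

Lemma pivot_factor_supp w v : w \notin v |: K v -> U w v = 0.
Proof. by move=> wv; rewrite mxE; case: (Yc v) => _ _ /(_ w wv). Qed.

Lemma pivot_factor_trig w v : (num w < num v)%N -> U w v = 0.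
Proof.
move=> wv; apply: pivot_factor_supp; rewrite !inE negb_or.
rewrite [(num v < num w)%N]ltnNge (ltnW wv) andbF andbT.
by apply: contraTneq wv => ->; rewrite ltnn.
Qed.

Lemma det_pivot_factor : \det U = 1.
Proof.
pose t := (num^-1)%g.
(* Taking rows and columns in elimination order makes [U] lower triangular; the two permutation
   signs cancel. *)
have <- : \det (row_perm t (col_perm t U)) = \det U.
  rewrite row_permE col_permE !det_mulmx !det_perm !odd_permV mulrCA.
  by rewrite -expr2 sqrr_sign mulr1.
rewrite det_trig.
  by rewrite big1 // => i _; rewrite !mxE -[RHS](pivot_factor_diag (t i)) mxE.
apply/is_trig_mxP => i j ij; have := @pivot_factor_trig (t i) (t j).
by rewrite !mxE => -> //; rewrite !permKV.
Qed.

Lemma pivot_factor_unit : U \in unitmx.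
Proof. by rewrite unitmxE det_pivot_factor unitr1. Qed.

(** Column [v] of [U] is supported on the clique of [v], so this entry sees [Z] only there, where
    all completions coincide. One [U] thus serves every completion. *)
Lemma congr_pivot_diag (Z : 'M[R]_n) v :
  {in v |: K v &, forall w t, Z w t = Y w t} -> (U^T *m Z *m U) v v = s v.
Proof.
move=> ZY; rewrite -mulmxA mxE; have [vS cv cS YcS] := Yc v.
rewrite -[RHS](schur_pivot_form (Yc v) cv cS).
apply: eq_bigr => w _; rewrite mxE [U w v]mxE.
have [wS|/cS ->] := boolP (w \in v |: K v); last by rewrite !mul0r.
congr (_ * _); rewrite mxE; apply: eq_bigr => t _; rewrite [U t v]mxE.
by have [tS|/cS ->] := boolP (t \in v |: K v); rewrite ?mulr0 // ZY.
Qed.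

Lemma pivot_gt0 v : 0 < s v.
Proof.
rewrite -(congr_pivot_diag (Z := Y)) //; apply: posdef_diag_gt0.
exact: posdef_congr pivot_factor_unit.
Qed.

Let Xhat : 'M[R]_n := (invmx U)^T *m D *m invmx U.

Lemma maxdet_factor : U^T *m Xhat *m U = D.
Proof.
rewrite /Xhat !mulmxA -trmx_mul mulVmx ?pivot_factor_unit // trmx1 mul1mx.
by rewrite mulmxKV ?pivot_factor_unit.
Qed.

Lemma maxdet_det : \det Xhat = \prod_v s v.
Proof.
have := congr1 determinant maxdet_factor.
rewrite !det_mulmx det_tr det_pivot_factor mul1r mulr1 => ->.
by rewrite det_diag; apply: eq_bigr => v _; rewrite mxE.
Qed.

Lemma maxdet_posdef : posdef Xhat.
Proof.
have Ui : invmx U \in unitmx by rewrite unitmx_inv pivot_factor_unit.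
apply: posdef_congr => //; split; first by rewrite tr_diag_mx.
move=> v v0; rewrite quad_formE.
have -> : \sum_i v i 0 * (\sum_j D i j * v j 0) = \sum_i s i * v i 0 ^+ 2.
  apply: eq_bigr => i _; rewrite (bigD1 i) //= big1 ?addr0.
    by rewrite !mxE eqxx mulr1n mulrCA -expr2.
  by move=> j ji; rewrite !mxE eq_sym (negPf ji) mulr0n mul0r.
have [i vi] : exists i, v i 0 != 0.
  apply/existsP; apply: contraNT v0 => /existsPn v0; apply/eqP/matrixP => i j.
  by rewrite ord1 mxE; have /negPn/eqP := v0 i.
rewrite (bigD1 i) //= ltr_wpDr //.
  by apply: sumr_ge0 => j _; rewrite mulr_ge0 ?sqr_ge0 // ltW ?pivot_gt0.
by rewrite mulr_gt0 ?pivot_gt0 // exprn_even_gt0.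
Qed.

Lemma maxdet_sym v w : Xhat v w = Xhat w v.
Proof. by have [h _] := maxdet_posdef; rewrite -[in LHS]h mxE. Qed.

(** Back substitution in [U^T *m G = D]: row [v] of [U^T] involves only [v] and later vertices [t],
    and [G t w] is already known to vanish since [t] comes strictly after [w]. *)
Lemma maxdet_mul_factor v w : (num w <= num v)%N ->
  (Xhat *m U) v w = if v == w then s v else 0.
Proof.
set G := Xhat *m U; have GD : U^T *m G = D by rewrite mulmxA maxdet_factor.
move: G GD => G GD; have [k] := ubnP (n - num v); elim: k v => // k IHk v kv wv.
have /matrixP/(_ v w) := GD.
rewrite !mxE (bigD1 v) //= mxE pivot_factor_diag mul1r big1.
  by rewrite addr0 => ->; case: eqP => [->|]; rewrite ?mulr1n.
move=> t tv; rewrite mxE; have [tv'|vt] := ltnP (num t) (num v).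
  by rewrite pivot_factor_trig // mul0r.
have {}vt : (num v < num t)%N.
  rewrite ltn_neqAle vt andbT; apply: contraNneq tv => /val_inj/perm_inj ->.
  by [].
rewrite IHk ?(leq_trans wv (ltnW vt)) //; last first.
  by have := ltn_ord (num t); lia.
rewrite (_ : t == w = false) ?mulr0 //; apply/negP => /eqP tw.
by move: wv; rewrite leqNgt -tw vt.
Qed.

Lemma mul_pivot_factor (Z : 'M[R]_n) w v :
  (Z *m U) w v = Z w v + \sum_(t in K v) Z w t * U t v.
Proof.
rewrite mxE (bigD1 v) //= pivot_factor_diag mulr1; congr (_ + _).
rewrite big_mkcond [RHS]big_mkcond; apply: eq_bigr => t _.
have [->|tv] := eqVneq t v; first by rewrite inE ltnn andbF.
case: ifPn => // tK; rewrite /= pivot_factor_supp ?mulr0 //.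
by rewrite finset.in_setU finset.in_set1 negb_or tv.
Qed.

(** Induction from the last vertex down. Entries inside [K v] lie in columns or rows of later
    vertices, so there [Xhat] and [Y] agree. Column [v] of [Xhat *m U] and of [Y *m U] coincide on
    the clique, and differ from column [v] of [Xhat] and of [Y] by sums over entries known to agree.
    This yields the column on [K v], and then, by symmetry, the diagonal entry. *)
Lemma maxdet_agree v :
  (forall w, w \in K v -> Xhat w v = Y w v) /\ Xhat v v = Y v v.
Proof.
have [k] := ubnP (n - num v); elim: k v => // k IHk v kv.
have [vS _ _ YcS] := Yc v.
have YU w : w \in v |: K v -> (Y *m U) w v = if w == v then s v else 0.
  by move=> /YcS <-; rewrite mxE; apply: eq_bigr => t _; rewrite mxE.
have lt w : w \in K v -> (n - num w < k)%N.
  by rewrite inE => /andP[_ vw]; have := ltn_ord (num w); lia.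
have sq : {in K v &, forall w t, Xhat w t = Y w t}.
  move=> w t wK tK; have [<-|wt] := eqVneq w t; first by case: (IHk w (lt w wK)).
  have Fwt : F w t.
    by move: wK tK; rewrite !inE => /andP[? ?] /andP[? ?]; apply: (higher_nbrs_adj (v := v)).
  have [nwt|] := ltnP (num w) (num t).
    rewrite maxdet_sym -(proj1 Ypd) [RHS]mxE.
    by apply: (proj1 (IHk w (lt w wK))); rewrite inE Fwt.
  rewrite leq_eqVlt => /orP[/eqP/val_inj/perm_inj tw|ntw].
    by rewrite tw eqxx in wt.
  by apply: (proj1 (IHk t (lt t tK))); rewrite inE chordal_extension_sym // Fwt.
have col w : w \in K v -> Xhat w v = Y w v.
  move=> wK; have wS : w \in v |: K v by rewrite inE wK orbT.
  have nvw : (num v < num w)%N by move: wK; rewrite inE => /andP[].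
  have := maxdet_mul_factor (ltnW nvw); have := YU w wS.
  have -> : (w == v) = false by apply: contraTF nvw => /eqP ->; rewrite ltnn.
  rewrite !mul_pivot_factor => YE XE; apply: (@addIr _ (\sum_(t in K v) Y w t * U t v)).
  by rewrite YE; apply: etrans XE; congr (_ + _); apply: eq_bigr => t tK; rewrite sq.
split=> //; have := maxdet_mul_factor (leqnn (num v)); have := YU v vS.
rewrite eqxx !mul_pivot_factor => YE XE.
apply: (@addIr _ (\sum_(t in K v) Y v t * U t v)); rewrite YE.
apply: etrans XE; congr (_ + _); apply: eq_bigr => t tK.
by rewrite maxdet_sym col // -[in LHS](proj1 Ypd) mxE.
Qed.

Lemma maxdet_agree_pattern v w : (v == w) || F v w -> Xhat v w = Y v w.
Proof.
have [<- _|vw /= Fvw] := eqVneq v w; first by case: (maxdet_agree v).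
have [nvw|] := ltnP (num v) (num w).
  rewrite maxdet_sym -(proj1 Ypd) [RHS]mxE.
  by apply: (proj1 (maxdet_agree v)); rewrite inE Fvw.
rewrite leq_eqVlt => /orP[/eqP/val_inj/perm_inj wv|nwv]; first by rewrite wv eqxx in vw.
by apply: (proj1 (maxdet_agree w)); rewrite inE chordal_extension_sym // Fvw.
Qed.

Lemma maxdet_completion_pivots (X : 'M[option R]_n) :
  specified_on F X -> pd_completion X Y ->
  exists Xhat : 'M[R]_n, maxdet_completion X Xhat /\ \det Xhat = \prod_v s v.
Proof.
move=> XF [[Ysym YX] _]; exists Xhat; split; last exact: maxdet_det.
have val i j x : X i j = Some x -> (i == j) || F i j by rewrite -XF => ->.
split.
  split; last exact: maxdet_posdef.
  split=> [|i j x Xij]; first by case: maxdet_posdef.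
  by rewrite maxdet_agree_pattern ?(val _ _ _ Xij) // (YX _ _ _ Xij).
move=> Z [[Zsym ZX] Zpd]; rewrite maxdet_det; have := hadamard_inequality (posdef_congr Zpd pivot_factor_unit).
rewrite !det_mulmx det_tr det_pivot_factor mul1r mulr1.
move=> /le_trans; apply; apply: ler_prod => v _.
rewrite ltW ?posdef_diag_gt0 //=; last exact: posdef_congr pivot_factor_unit.
rewrite congr_pivot_diag // => w t wS tS.
(* The clique of [v] is fully specified, so [Z] and [Y] both take the values of [X] on it. *)
have : isSome (X w t).
  rewrite XF; have [//|wt /=] := eqVneq w t.
  move: wS tS; rewrite !inE.
  case: (eqVneq w v) wt => [-> wt _|wv wt /= /andP[Fvw vw]].
    by case: (eqVneq t v) => [tv|_ /andP[]//]; rewrite tv eqxx in wt.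
  case: (eqVneq t v) => [-> _|tv /= /andP[Fvt vt]]; first by rewrite chordal_extension_sym.
  exact: (higher_nbrs_adj (v := v)).
by case Xwt: (X w t) => [x|//] _; rewrite (ZX _ _ _ Xwt) (YX _ _ _ Xwt).
Qed.

End MaxDet.

(** * Gaussian elimination *)

Section GaussianElimination.
Variable R : realType.
Implicit Types (A : nat -> nat -> R) (c : nat -> R).

(** Row and column [p] are kept instead of being cleared: later stages do not read them, and an
    in-place stage can go on reading them while it runs. *)
Definition elim_step (p : nat) A : nat -> nat -> R := fun i j =>
  if (p < i)%N && (p < j)%N then A i j - A i p * A p j / A p p else A i j.

(* Rows and columns are numbered from 1. *)
Fixpoint elim_stage A (q : nat) : nat -> nat -> R :=
  if q is q'.+1 then elim_step q (elim_stage A q') else A.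

Definition pd_range (lo hi : nat) A : Prop := forall c,
  (exists2 i, (lo <= i < hi)%N & c i != 0) ->
  0 < \sum_(lo <= i < hi) c i * \sum_(lo <= j < hi) A i j * c j.

Lemma pd_range_pivot_gt0 lo hi A : (lo < hi)%N -> pd_range lo hi A -> 0 < A lo lo.
Proof.
move=> lohi /(_ (fun i => (i == lo)%:R)); rewrite big_ltn //= eqxx mul1r.
rewrite big_ltn //= eqxx mulr1.
rewrite [X in _ + X + _]big1_seq ?addr0; last first.
  move=> i; rewrite mem_index_iota => /andP[_ /andP[lo_i _]].
  by rewrite gtn_eqF ?mulr0.
rewrite big1_seq ?addr0; first by apply; exists lo; rewrite ?leqnn // eqxx oner_eq0.
move=> i; rewrite mem_index_iota => /andP[_ /andP[lo_i _]].
by rewrite gtn_eqF ?mul0r.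
Qed.

(** The coordinate at [p] solves row [p], so the remaining rows act on [c] as the eliminated matrix.
    This serves both to transfer positive definiteness and to lift solutions. *)
Definition back_subst A (p hi : nat) c : nat -> R := fun j =>
  if j == p then - (\sum_(p.+1 <= i < hi) A p i * c i) / A p p else c j.

Lemma back_substE A p hi c i : (p < hi)%N -> A p p != 0 ->
  \sum_(p <= j < hi) A i j * back_subst A p hi c j =
  \sum_(p.+1 <= j < hi) (A i j - A i p * A p j / A p p) * c j.
Proof.
move=> phi App; rewrite big_ltn // {1}/back_subst eqxx mulrA mulrN mulr_sumr.
rewrite mulNr mulr_suml addrC -sumrB; apply: eq_big_nat => j /andP[pj _].
by rewrite /back_subst gtn_eqF // mulrBl; congr (_ - _); field.
Qed.

Lemma back_subst_pivot A p hi c : (p < hi)%N -> A p p != 0 ->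
  \sum_(p <= j < hi) A p j * back_subst A p hi c j = 0.
Proof.
move=> phi App; rewrite back_substE // big1 // => j _.
by rewrite [_ * A p j]mulrC mulfK // subrr mul0r.
Qed.

Lemma back_subst_row A p hi c i : (p < hi)%N -> A p p != 0 -> (p < i)%N ->
  \sum_(p <= j < hi) A i j * back_subst A p hi c j =
  \sum_(p.+1 <= j < hi) elim_step p A i j * c j.
Proof.
move=> phi App pi; rewrite back_substE //; apply: eq_big_nat => j /andP[pj _].
by rewrite /elim_step pi pj.
Qed.

Lemma pd_range_elim_step A p hi : (p < hi)%N -> pd_range p hi A ->
  pd_range p.+1 hi (elim_step p A).
Proof.
move=> phi Apd c [i /andP[pi ihi] ci].
have App : A p p != 0 by rewrite gt_eqF ?(pd_range_pivot_gt0 phi).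
have := Apd (back_subst A p hi c); rewrite big_ltn // back_subst_pivot // mulr0 add0r.
rewrite (eq_big_nat _ _ (F2 := fun i => c i *
    \sum_(p.+1 <= j < hi) elim_step p A i j * c j)); last first.
  by move=> j /andP[pj jhi]; rewrite back_subst_row // {1}/back_subst gtn_eqF.
apply; exists i; first by rewrite ltnW.
by rewrite /back_subst gtn_eqF.
Qed.

(** Back substitution lifts a solution for the trailing block one stage back, starting from the 1 by
    1 block left after [k] stages. At [q = 0] it exhibits the last pivot as a Schur complement of
    the whole matrix. *)
Lemma elim_stage_solution A k d q : (q + d)%N = k ->
  pd_range q.+1 k.+2 (elim_stage A q) ->
  exists c, c k.+1 = 1 /\ forall i, (q < i <= k.+1)%N ->
    \sum_(q.+1 <= j < k.+2) elim_stage A q i j * c j =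
    if i == k.+1 then elim_stage A k k.+1 k.+1 else 0.
Proof.
elim: d q => [|d IHd] q qk Apd.
  rewrite addn0 in qk; exists (fun=> 1); split=> // i; rewrite qk => ki.
  have -> : i = k.+1 by lia.
  by rewrite big_nat1 mulr1 eqxx.
have qlt : (q.+1 < k.+2)%N by lia.
have Aqq : elim_stage A q q.+1 q.+1 != 0 by rewrite gt_eqF ?(pd_range_pivot_gt0 qlt).
have [||c [ck csol]] := IHd q.+1; first by lia.
  exact: pd_range_elim_step.
exists (back_subst (elim_stage A q) q.+1 k.+2 c); split.
  by rewrite /back_subst gtn_eqF //; lia.
move=> i /andP[qi ik]; have [->|iq] := eqVneq i q.+1.
  by rewrite back_subst_pivot // ltn_eqF //; lia.
have {iq}qi : (q.+1 < i)%N by lia.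
by rewrite back_subst_row // csol // qi.
Qed.

(** The outer loop of the program also runs the stage of the last index, which has nothing left to
    update. *)
Lemma elim_stage_last A q : elim_stage A q.+1 q.+1 q.+1 = elim_stage A q q.+1 q.+1.
Proof. by rewrite /= /elim_step ltnn. Qed.

Section LocalMatrix.
Variables (n : nat) (Y : 'M[R]_n) (v : 'I_n) (ks : seq 'I_n).
Hypothesis Ypd : posdef Y.
Hypothesis ks_uniq : uniq (rcons ks v).

Definition local_matrix : nat -> nat -> R := fun i j =>
  Y (nth v (rcons ks v) i.-1) (nth v (rcons ks v) j.-1).

Let pull (c : nat -> R) (w : 'I_n) : R :=
  if w \in rcons ks v then c (index w (rcons ks v)).+1 else 0.

Lemma sum_local (f : 'I_n -> R) : (forall w, w \notin rcons ks v -> f w = 0) ->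
  \sum_w f w = \sum_(1 <= i < (size ks).+2) f (nth v (rcons ks v) i.-1).
Proof.
move=> f0; rewrite big_add1 -{1}(size_rcons ks v) -(big_nth v xpredT f).
rewrite [RHS]big_uniq // [RHS]big_mkcond; apply: eq_bigr => w _.
by case: ifPn => // /f0.
Qed.

Lemma pull_nth c i : (1 <= i < (size ks).+2)%N ->
  pull c (nth v (rcons ks v) i.-1) = c i.
Proof.
case: i => // i; rewrite ltnS /= => ilt.
by rewrite /pull mem_nth ?size_rcons // index_uniq ?size_rcons.
Qed.

Lemma local_row c i : \sum_t Y (nth v (rcons ks v) i.-1) t * pull c t =
  \sum_(1 <= j < (size ks).+2) local_matrix i j * c j.
Proof.
rewrite sum_local; last by move=> w wks; rewrite /pull (negPf wks) mulr0.
by apply: eq_big_nat => j jlt; rewrite pull_nth.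
Qed.

Lemma local_pd : pd_range 1 (size ks).+2 local_matrix.
Proof.
move=> c [i ilt ci]; have := proj2 Ypd (\col_w pull c w); rewrite quad_formE.
rewrite (_ : \sum_w _ = \sum_(1 <= i < (size ks).+2)
    c i * \sum_(1 <= j < (size ks).+2) local_matrix i j * c j); last first.
  rewrite sum_local; last by move=> w wks; rewrite mxE /pull (negPf wks) mul0r.
  apply: eq_big_nat => j jlt; rewrite mxE pull_nth // -local_row.
  by congr (_ * _); apply: eq_bigr => t _; rewrite mxE.
apply; apply: contraNneq ci => /matrixP/(_ (nth v (rcons ks v) i.-1) 0).
by rewrite !mxE pull_nth // => ->.
Qed.

Lemma elim_schur_pivot : exists c : 'I_n -> R,
  schur_pivot Y [set w in rcons ks v] v
    (elim_stage local_matrix (size ks).+1 (size ks).+1 (size ks).+1) c.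
Proof.
have [//||c [ck csol]] := @elim_stage_solution local_matrix (size ks) (size ks) 0.
  exact: local_pd.
have vks : v \in rcons ks v by rewrite mem_rcons mem_head.
have iv : index v (rcons ks v) = size ks.
  move: ks_uniq; rewrite rcons_uniq => /andP[/negPf vNks _].
  by rewrite -cats1 index_cat vNks /= eqxx addn0.
exists (pull c); split; first by rewrite inE.
- by rewrite /pull vks iv.
- by move=> w; rewrite inE /pull => /negPf ->.
move=> w; rewrite inE => wks; have := local_row c (index w (rcons ks v)).+1.
rewrite succnK nth_index // => ->; rewrite csol; last first.
  by rewrite !ltnS /= -ltnS -(size_rcons ks v) index_mem.
rewrite elim_stage_last eqSS -iv; congr (if _ then _ else _).
apply/eqP/eqP => [|-> //]; exact: index_inj.
Qed.

End LocalMatrix.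
End GaussianElimination.

(** * Reasoning about programs *)

(** The number of operations of an expression does not depend on the memory, whereas the cells it
    reads do. Time is therefore read off the syntax, and only values and space are tracked along a
    run. *)
Fixpoint iops (a : iexp) : nat :=
  match a with
  | INum _ => 1
  | IGet b => (iops b).+1
  | IBin _ b c => (iops b + iops c).+1
  end.

Fixpoint rops (a : rexp) : nat :=
  match a with
  | ROfI b => (iops b).+1
  | RGet b => (iops b).+1
  | RBin _ b c => (rops b + rops c).+1
  | RFun _ b => (rops b).+1
  end.

Definition tops (t : test) : nat :=
  match t with
  | ILe a b => (iops a + iops b).+1
  | RLe a b => (rops a + rops b).+1
  end.

Lemma ops_icost (R : realType) (M : memory R) a : ops (icost M a) = iops a.
Proof. by elim: a => [//|a IHa|o a IHa b IHb] /=; rewrite ?IHa ?IHb addn1. Qed.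

Lemma ops_rcost (R : realType) (M : memory R) a : ops (rcost M a) = rops a.
Proof.
by elim: a => [a|a|o a IHa b IHb|o a IHa] /=; rewrite ?ops_icost ?IHa ?IHb addn1.
Qed.

Lemma ops_tcost (R : realType) (M : memory R) t : ops (tcost M t) = tops t.
Proof. by case: t => a b /=; rewrite ?ops_icost ?ops_rcost addn1. Qed.

Lemma rcells_icost (R : realType) (M : memory R) a : rcells (icost M a) = 0%N.
Proof. by elim: a => [//|a IHa|o a IHa b IHb] /=; rewrite ?IHa ?IHb. Qed.

Definition iadd := IBin IAdd.
Definition isub := IBin ISub.
Definition imul := IBin IMul.

Definition icount : iexp := IGet (INum 0).
Definition isize : iexp := IGet (INum 1).
Definition ibase : iexp := iadd (INum 2) (iadd icount (iadd isize isize)).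
Definition avar (x : nat) : iexp := iadd ibase (INum x).
Definition ivar (x : nat) : iexp := IGet (avar x).
Definition atab (a : iexp) : iexp := iadd (iadd ibase (INum 6)) a.
Definition itab (a : iexp) : iexp := IGet (atab a).
Definition inumber (a : iexp) : iexp := IGet (iadd (INum 2) a).
Definition irow (a : iexp) : iexp := IGet (iadd (iadd (INum 2) icount) a).
Definition icol (a : iexp) : iexp := IGet (iadd (iadd (iadd (INum 2) icount) isize) a).
Definition amat (a : iexp) : iexp := iadd (iadd (INum 1) isize) a.

(** Tests being of the form [<=], the condition [x < hi] is shifted by one. As [hi] is evaluated
    again at each turn, the loop invariant has to maintain its value. *)
Definition for_loop (x : nat) (lo hi : iexp) (body : program) : program :=
  Seq (IPut (avar x) lo)
    (While (ILe (iadd (INum 1) (ivar x)) hi)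
       (Seq body (IPut (avar x) (iadd (INum 1) (ivar x))))).

(* Behind the input, whose cells have no fixed length, the integer memory holds
   6 variables and a table with one cell per vertex; the real memory holds an
   accumulator and a matrix. *)
Record state (R : realType) := State {
  vars : nat -> nat; tab : nat -> nat; acc : R; mat : nat -> R }.

(** * Rules for values, time and space of program runs *)

Section Runs.
Variables (R : realType) (n : nat) (num : 'S_n) (l : seq ('I_n * 'I_n * R)).
Variable w : nat.

Local Notation state := (state R).
Local Notation inp := (input_ints num l).
Local Notation base := (2 + (n + (size l + size l)))%N.
Local Notation icap := (base + 6 + n)%N.
Local Notation rcap := (1 + size l + w * w)%N.

(** The input part does not depend on the state, so a memory of this form still holds the input
    unchanged. *)
Definition mem_of (s : state) : memory R := Memory
  (fun a => if (a < base)%N then nth 0%N inp a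
            else if (a < base + 6)%N then vars s (a - base)
            else tab s (a - (base + 6)))
  (fun a => if (a < size l)%N then nth 0 (input_reals l) a
            else if a == size l then acc s else mat s (a - (1 + size l))).

Lemma imem_ofE s a : imem (mem_of s) a =
  if (a < base)%N then nth 0%N inp a
  else if (a < base + 6)%N then vars s (a - base) else tab s (a - (base + 6)).
Proof. by []. Qed.

Lemma rmem_ofE s a : rmem (mem_of s) a =
  if (a < size l)%N then nth 0 (input_reals l) a
  else if a == size l then acc s else mat s (a - (1 + size l)).
Proof. by []. Qed.

Definition set_var (s : state) x k : state :=
  State (fun y => if y == x then k else vars s y) (tab s) (acc s) (mat s).
Definition set_tab (s : state) x k : state :=
  State (vars s) (fun y => if y == x then k else tab s y) (acc s) (mat s).
Definition set_acc (s : state) x : state :=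
  State (vars s) (tab s) x (mat s).
Definition set_mat (s : state) x k : state :=
  State (vars s) (tab s) (acc s) (fun y => if y == x then k else mat s y).

Lemma size_input_ints : size inp = base.
Proof. by rewrite /input_ints !size_cat 3!size_map size_enum_ord. Qed.

Lemma size_input_reals : size (input_reals l) = size l.
Proof. by rewrite size_map. Qed.

Lemma input_memoryE : input_memory num l = mem_of (State (fun=> 0%N) (fun=> 0%N) 0 (fun=> 0)).
Proof.
congr Memory; apply/funext => a.
  by case: ltnP => // h; rewrite if_same nth_default // size_input_ints.
by case: ltnP => // h; rewrite if_same nth_default // size_input_reals.
Qed.

Lemma iput_var s x k : (x < 6)%N ->
  iput (mem_of s) (base + x) k = mem_of (set_var s x k).
Proof.
move=> x6; congr Memory; apply/funext => a /=.
case: (eqVneq a (base + x)%N) => [->|ax].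
  by rewrite ltnNge leq_addr /= ltn_add2l x6 addnC addnK eqxx.
case: (ltnP a base) => // ab; case: (ltnP a (base + 6)) => // a6.
by rewrite ifF //; apply/eqP => h; move: ax; rewrite -h subnKC // eqxx.
Qed.

Lemma iput_tab s x k : iput (mem_of s) (base + 6 + x) k = mem_of (set_tab s x k).
Proof.
congr Memory; apply/funext => a /=.
case: (eqVneq a (base + 6 + x)%N) => [->|ax].
  have h1 : (base + 6 + x < base)%N = false by apply/negP; lia.
  have h2 : (base + 6 + x < base + 6)%N = false by apply/negP; lia.
  by rewrite h1 h2 [(_ + x)%N]addnC addnK eqxx.
case: (ltnP a base) => // ab; case: (ltnP a (base + 6)) => // a6.
by rewrite ifF //; apply/eqP => h; move: ax; rewrite -h subnKC // eqxx.
Qed.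

Lemma rput_acc s k : rput (mem_of s) (size l) k = mem_of (set_acc s k).
Proof.
congr Memory; apply/funext => a /=.
by case: (eqVneq a (size l)) => // ->; rewrite ltnn.
Qed.

Lemma rput_mat s x k : rput (mem_of s) (1 + size l + x) k = mem_of (set_mat s x k).
Proof.
congr Memory; apply/funext => a /=.
case: (eqVneq a (1 + size l + x)%N) => [->|ax].
  have h1 : (1 + size l + x < size l)%N = false by apply/negP; lia.
  have h2 : (1 + size l + x == size l)%N = false by apply/negP; lia.
  by rewrite h1 h2 [(_ + x)%N]addnC addnK eqxx.
case: (ltnP a (size l)) => // ab; case: (eqVneq a (size l)) => // a6.
rewrite ifF //; apply/eqP => h; move: ax; rewrite -h subnKC ?eqxx //.
by rewrite add1n ltn_neqAle eq_sym a6.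
Qed.

Definition ival (s : state) (a : iexp) (k : nat) : Prop :=
  ieval (mem_of s) a = k /\ (icells (icost (mem_of s) a) <= icap)%N.

Definition rval (s : state) (a : rexp) (k : R) : Prop :=
  [/\ reval (mem_of s) a = k, (icells (rcost (mem_of s) a) <= icap)%N &
      (rcells (rcost (mem_of s) a) <= rcap)%N].

Lemma ival_num s k : ival s (INum k) k.
Proof. by split. Qed.

Lemma ival_bin s o a b x y : ival s a x -> ival s b y ->
  ival s (IBin o a b) (iop_val o x y).
Proof.
by move=> [ax ac] [bx bc]; split; rewrite /= ?ax ?bx // !geq_max ac bc.
Qed.

Lemma ival_get s a x : ival s a x -> (x < icap)%N -> ival s (IGet a) (imem (mem_of s) x).
Proof. by move=> [ax ac] xI; split; rewrite /= ?ax // geq_max ac. Qed.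

Lemma ival_get_eq s a x y : ival s a x -> (x < icap)%N -> imem (mem_of s) x = y ->
  ival s (IGet a) y.
Proof. by move=> ax xI <-; apply: ival_get. Qed.

Lemma ival_add s a b x y : ival s a x -> ival s b y -> ival s (iadd a b) (x + y).
Proof. exact: (@ival_bin s IAdd). Qed.

Lemma ival_sub s a b x y : ival s a x -> ival s b y -> ival s (isub a b) (x - y).
Proof. exact: (@ival_bin s ISub). Qed.

Lemma ival_mul s a b x y : ival s a x -> ival s b y -> ival s (imul a b) (x * y).
Proof. exact: (@ival_bin s IMul). Qed.

Lemma ival_icount s : ival s icount n.
Proof. exact: (ival_get (ival_num s 0)). Qed.

Lemma ival_isize s : ival s isize (size l).
Proof. exact: (ival_get (ival_num s 1)). Qed.

Lemma ival_ibase s : ival s ibase base.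
Proof.
apply: ival_add (ival_num _ _) _; apply: ival_add (ival_icount _) _.
by apply: ival_add; apply: ival_isize.
Qed.

Lemma ival_avar s x : ival s (avar x) (base + x).
Proof. exact: ival_add (ival_ibase s) (ival_num s x). Qed.

Lemma ival_ivar s x : (x < 6)%N -> ival s (ivar x) (vars s x).
Proof.
move=> x6; apply: ival_get_eq (ival_avar s x) _ _; first by lia.
by rewrite imem_ofE ltnNge leq_addr ltn_add2l x6 addKn.
Qed.

Lemma ival_atab s a x : ival s a x -> ival s (atab a) (base + 6 + x).
Proof. by apply: ival_add; apply: ival_add (ival_ibase s) (ival_num s _). Qed.

Lemma ival_itab s a x : ival s a x -> (x < n)%N -> ival s (itab a) (tab s x).
Proof.
move=> ax xn; apply: ival_get_eq (ival_atab ax) _ _; first by rewrite ltn_add2l.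
have h1 : (base + 6 + x < base)%N = false by apply/negP; lia.
have h2 : (base + 6 + x < base + 6)%N = false by apply/negP; lia.
by rewrite imem_ofE h1 h2 addKn.
Qed.

Lemma ival_inumber s a (v : 'I_n) : ival s a v -> ival s (inumber a) (num v).
Proof.
move=> av; have vb : (2 + v < base)%N by have := ltn_ord v; lia.
apply: ival_get_eq (ival_add (ival_num s 2) av) _ _; first by lia.
rewrite imem_ofE vb nth_cat ltnNge leq_addr addKn.
rewrite nth_cat size_map size_enum_ord ltn_ord.
by rewrite (nth_map v) ?size_enum_ord // nth_ord_enum.
Qed.

Lemma ival_irow s a t x0 : ival s a t -> (t < size l)%N ->
  ival s (irow a) (nth x0 l t).1.1.
Proof.
move=> av tl; have vb : (2 + n + t < base)%N by lia.
apply: ival_get_eq (ival_add (ival_add (ival_num s 2) (ival_icount s)) av) _ _; first by lia.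
rewrite imem_ofE vb -addnA nth_cat ltnNge leq_addr addKn.
rewrite nth_cat size_map size_enum_ord ltnNge leq_addr addKn.
by rewrite nth_cat size_map tl (nth_map x0).
Qed.

Lemma ival_icol s a t x0 : ival s a t -> (t < size l)%N ->
  ival s (icol a) (nth x0 l t).1.2.
Proof.
move=> av tl; have vb : (2 + n + size l + t < base)%N by lia.
apply: ival_get_eq
  (ival_add (ival_add (ival_add (ival_num s 2) (ival_icount s)) (ival_isize s)) av) _ _.
  by lia.
rewrite imem_ofE vb -!addnA nth_cat ltnNge leq_addr addKn.
rewrite nth_cat size_map size_enum_ord ltnNge leq_addr addKn.
by rewrite nth_cat size_map ltnNge leq_addr addKn; apply: (nth_map x0).
Qed.

Lemma ival_amat s a x : ival s a x -> ival s (amat a) (1 + size l + x).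
Proof. by apply: ival_add; apply: ival_add (ival_num s _) (ival_isize s). Qed.

Lemma rval_get s a x y : ival s a x -> (x < rcap)%N -> rmem (mem_of s) x = y ->
  rval s (RGet a) y.
Proof.
move=> [ax ac] xJ <-; split; rewrite /= ?ax // geq_max ?ac ?andbT //.
by rewrite rcells_icost.
Qed.

Lemma rval_bin s o a b x y : rval s a x -> rval s b y -> rval s (RBin o a b) (rop_val o x y).
Proof.
move=> [ax ac ar] [bx bc br].
by split; rewrite /= ?ax ?bx // !geq_max ?ac ?bc ?ar ?br.
Qed.

Lemma rval_fun s o a x : rval s a x -> rval s (RFun o a) (rfun_val o x).
Proof. by move=> [ax ac ar]; split; rewrite /= ?ax // !geq_max ?ac ?ar. Qed.

Lemma rval_entry s a t x0 : ival s a t -> (t < size l)%N ->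
  rval s (RGet a) (nth x0 l t).2.
Proof.
move=> av tl; apply: rval_get av _ _; first by lia.
by rewrite rmem_ofE tl (nth_map x0).
Qed.

Lemma rval_acc s : rval s (RGet isize) (acc s).
Proof.
by apply: rval_get (ival_isize s) _ _; [lia | rewrite rmem_ofE ltnn eqxx].
Qed.

Lemma rval_mat s a x : ival s a x -> (x < w * w)%N -> rval s (RGet (amat a)) (mat s x).
Proof.
move=> ax xw; apply: rval_get (ival_amat ax) _ _; first by lia.
have h1 : (1 + size l + x < size l)%N = false by apply/negP; lia.
have h2 : (1 + size l + x == size l)%N = false by apply/negP; lia.
by rewrite rmem_ofE h1 h2 addKn.
Qed.

Definition runs (p : program) (s : state) (T : nat) (Q : state -> Prop) : Prop :=
  exists k s', exec p (mem_of s) k (mem_of s') /\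
  [/\ (ops k <= T)%N, (icells k <= icap)%N, (rcells k <= rcap)%N & Q s'].

Lemma runs_weaken p s T T' (Q Q' : state -> Prop) : (T <= T')%N ->
  (forall s', Q s' -> Q' s') -> runs p s T Q -> runs p s T' Q'.
Proof.
move=> TT QQ [k [s' [ex [kT kI kJ Qs]]]]; exists k, s'; split=> //.
by split=> //; [apply: leq_trans TT | apply: QQ].
Qed.

Lemma runs_skip s T (Q : state -> Prop) : (0 < T)%N -> Q s -> runs Skip s T Q.
Proof. by move=> T0 Qs; exists one_op, s; split; [apply: exec_skip|]. Qed.

Lemma runs_seq p q s T T' (Q1 Q : state -> Prop) : runs p s T Q1 ->
  (forall s', Q1 s' -> runs q s' T' Q) -> runs (Seq p q) s (T + T') Q.
Proof.
move=> [k [s1 [ex1 [kT kI kJ Qs1]]]] /(_ _ Qs1) [k2 [s2 [ex2 [kT2 kI2 kJ2 Qs2]]]].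
exists (cost_add k k2), s2; split; first exact: exec_seq ex1 ex2.
by rewrite /= !geq_max kI kI2 kJ kJ2 leq_add.
Qed.

Lemma runs_iput s a e x k T M' (Q : state -> Prop) : ival s a x -> ival s e k ->
  (x < icap)%N -> iput (mem_of s) x k = mem_of M' -> (iops a + iops e < T)%N -> Q M' ->
  runs (IPut a e) s T Q.
Proof.
move=> [ax ac] [ek ec] xI sE sT Qs.
exists (cost_add (cost_add (icost (mem_of s) a) (icost (mem_of s) e))
         (access_int (ieval (mem_of s) a))), M'; split.
  by rewrite -sE -ax -ek; apply: exec_iput.
by rewrite /= !ops_icost !rcells_icost addn1 ax !geq_max ac ec.
Qed.

Lemma runs_set_var s x e k T (Q : state -> Prop) : (x < 6)%N -> ival s e k ->
  (12 + iops e < T)%N -> Q (set_var s x k) -> runs (IPut (avar x) e) s T Q.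
Proof.
move=> x6 ek sT Qs; apply: runs_iput (ival_avar s x) ek _ (iput_var _ _ x6) sT Qs.
by lia.
Qed.

Lemma runs_set_tab s a e x k T (Q : state -> Prop) : ival s a x -> (x < n)%N ->
  ival s e k -> (13 + iops a + iops e < T)%N -> Q (set_tab s x k) ->
  runs (IPut (atab a) e) s T Q.
Proof.
move=> ax xn ek sT Qs; apply: runs_iput (ival_atab ax) ek _ (iput_tab _ _ _) _ Qs.
  by rewrite ltn_add2l.
by move: sT; rewrite /=; lia.
Qed.

Lemma runs_rput s a e x k T M' (Q : state -> Prop) : ival s a x -> rval s e k ->
  (x < rcap)%N -> rput (mem_of s) x k = mem_of M' -> (iops a + rops e < T)%N -> Q M' ->
  runs (RPut a e) s T Q.
Proof.
move=> [ax ac] [ek ec er] xI sE sT Qs.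
exists (cost_add (cost_add (icost (mem_of s) a) (rcost (mem_of s) e))
         (access_real (ieval (mem_of s) a))), M'; split.
  by rewrite -sE -ax -ek; apply: exec_rput.
by rewrite /= !ops_icost !ops_rcost !rcells_icost addn1 ax !geq_max ac ec er.
Qed.

Lemma runs_set_acc s e k T (Q : state -> Prop) : rval s e k ->
  (2 + rops e < T)%N -> Q (set_acc s k) -> runs (RPut isize e) s T Q.
Proof.
move=> ek sT Qs; apply: runs_rput (ival_isize s) ek _ (rput_acc _ _) sT Qs; lia.
Qed.

Lemma runs_set_mat s a e x k T (Q : state -> Prop) : ival s a x -> (x < w * w)%N ->
  rval s e k -> (5 + iops a + rops e < T)%N -> Q (set_mat s x k) ->
  runs (RPut (amat a) e) s T Q.
Proof.
move=> ax xw ek sT Qs; apply: runs_rput (ival_amat ax) ek _ (rput_mat _ _ _) _ Qs.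
  lia.
by move: sT; rewrite /=; lia.
Qed.

Lemma runs_if_le a b x y p q s T T' (Q : state -> Prop) : ival s a x -> ival s b y ->
  (iops a + iops b < T')%N ->
  runs (if (x <= y)%N then p else q) s T Q ->
  runs (If (ILe a b) p q) s (T' + T) Q.
Proof.
move=> [ax ac] [bx bc] sT [k [s' [ex [kT kI kJ Qs]]]].
exists (cost_add (tcost (mem_of s) (ILe a b)) k), s'; split.
  by apply: exec_if; rewrite /= ax bx.
split=> //; rewrite /= ?ops_icost ?rcells_icost ?geq_max ?ac ?bc //.
by rewrite leq_add // addn1.
Qed.

Lemma runs_for x lo hi body a b s T (Inv : nat -> state -> Prop) :
  (x < 6)%N -> (iops lo <= 20)%N -> (iops hi <= 20)%N -> ival s lo a -> (a <= b)%N ->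
  Inv a (set_var s x a) ->
  (forall k s, (a <= k <= b)%N -> vars s x = k -> Inv k s -> ival s hi b) ->
  (forall k s, (a <= k < b)%N -> vars s x = k -> Inv k s ->
     runs body s T (fun s' => vars s' x = k /\ Inv k.+1 (set_var s' x k.+1))) ->
  runs (for_loop x lo hi body) s (100 + (b - a) * (T + 100)) (Inv b).
Proof.
move=> x6 losz hisz loa ab Inv0 hib Hbody.
(* 40 operations cover the initial assignment, 50 the last, failing test, and the extra 100 per turn
   the test and the increment. *)
apply: (@runs_weaken _ _ (40 + (50 + (b - a) * (T + 100))) _ (Inv b)) => //; first by lia.
apply: (@runs_seq _ _ _ _ _ (fun s => vars s x = a /\ Inv a s)).
  by apply: (runs_set_var x6 loa); [lia | split=> //=; rewrite eqxx].
suff loop k s' : (a <= k)%N -> (k <= b)%N -> vars s' x = k -> Inv k s' ->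
    runs (While (ILe (iadd (INum 1) (ivar x)) hi)
       (Seq body (IPut (avar x) (iadd (INum 1) (ivar x))))) s'
      (50 + (b - k) * (T + 100)) (Inv b).
  by move=> s' [sx Is]; apply: loop.
move=> ak kb sx Is; have [d] := ubnP (b - k); elim: d k s' ak kb sx Is => // d IHd k s' ak kb sx Is kd.
have hi_b : ival s' hi b by apply: hib Is; rewrite ?ak.
have x1 : ival s' (iadd (INum 1) (ivar x)) k.+1.
  by rewrite -sx -add1n; apply: ival_add (ival_num _ _) (ival_ivar _ x6).
pose tc := tcost (mem_of s') (ILe (iadd (INum 1) (ivar x)) hi).
have tcT : (ops tc <= 40)%N by rewrite ops_tcost /=; lia.
have tcI : (icells tc <= icap)%N.
  have -> : icells tc = maxn (maxn (icells (icost (mem_of s') (iadd (INum 1) (ivar x))))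
    (icells (icost (mem_of s') hi))) 0 by [].
  by rewrite !geq_max (proj2 x1) (proj2 hi_b).
have tcJ : (rcells tc <= rcap)%N by rewrite /tc /= !rcells_icost.
have tE : teval (mem_of s') (ILe (iadd (INum 1) (ivar x)) hi) = (k < b)%N.
  by rewrite /teval (proj1 hi_b) (proj1 x1).
have [kltb|bk] := ltnP k b; last first.
  have -> : b = k by lia.
  exists tc, s'; split; first by apply: exec_while_end; rewrite tE -leqNgt.
  by split=> //; lia.
have [k1 [s1 [ex1 [T1 I1 J1 [sx1 Is1]]]]] : runs (Seq body (IPut (avar x) (iadd (INum 1) (ivar x)))) s'
    (T + 40) (fun s => vars s x = k.+1 /\ Inv k.+1 s).
  apply: runs_seq; first by apply: Hbody Is => //; rewrite ak.
  move=> s1 [sx1 Is1]; apply: (@runs_set_var _ _ _ k.+1) => //.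
    by rewrite -sx1 -add1n; apply: ival_add (ival_num _ _) (ival_ivar _ x6).
  by split=> //=; rewrite eqxx.
have [|||k2 [s2 [ex2 [T2 I2 J2 Is2]]]] := IHd k.+1 s1 _ _ sx1 Is1; try lia.
exists (cost_add tc (cost_add k1 k2)), s2; split.
  by apply: exec_while_step ex1 ex2; rewrite tE.
clearbody tc; split; rewrite ?geq_max ?I1 ?I2 ?J1 ?J2 ?tcI ?tcJ //.
have -> : (b - k = (b - k.+1).+1)%N by lia.
by rewrite mulSn [ops _]/=; lia.
Qed.

End Runs.

(** * The program *)

(** Variable 0 holds the current vertex, 1 the next free clique position, 2 the index of a scan, and
    3, 4, 5 the indices of the elimination. *)
Definition push (a : iexp) : program :=
  Seq (IPut (atab a) (ivar 1)) (IPut (avar 1) (iadd (INum 1) (ivar 1))).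

(* Truncated subtraction makes this single test say that [a] is the current
   vertex and that [b] has a larger number. *)
Definition nbr_test (a b : iexp) : test :=
  ILe (iadd (iadd (isub a (ivar 0)) (isub (ivar 0) a))
         (isub (iadd (INum 1) (inumber (ivar 0))) (inumber b))) (INum 0).

Definition scan_nbrs : program :=
  Seq (If (nbr_test (irow (ivar 2)) (icol (ivar 2))) (push (icol (ivar 2))) Skip)
      (If (nbr_test (icol (ivar 2)) (irow (ivar 2))) (push (irow (ivar 2))) Skip).

Definition acell (a b : iexp) : iexp := iadd (imul a (ivar 1)) b.
Definition put_cell (a b : iexp) (x : rexp) : program := RPut (amat (acell a b)) x.
Definition get_cell (a b : iexp) : rexp := RGet (amat (acell a b)).

(** Clique positions start at 1 and 0 marks absence, so the product is positive exactly when both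
    endpoints are in the clique. The value of entry number k sits at real address k. *)
Definition scan_entries : program :=
  If (ILe (INum 1) (imul (itab (irow (ivar 2))) (itab (icol (ivar 2)))))
    (Seq (put_cell (itab (irow (ivar 2))) (itab (icol (ivar 2))) (RGet (ivar 2)))
         (put_cell (itab (icol (ivar 2))) (itab (irow (ivar 2))) (RGet (ivar 2))))
    Skip.

Definition update_cell : program :=
  put_cell (ivar 4) (ivar 5)
    (RBin RSub (get_cell (ivar 4) (ivar 5))
       (RBin RDiv (RBin RMul (get_cell (ivar 4) (ivar 3)) (get_cell (ivar 3) (ivar 5)))
          (get_cell (ivar 3) (ivar 3)))).

Definition eliminate_matrix : program :=
  for_loop 3 (INum 1) (ivar 1)
    (for_loop 4 (iadd (INum 1) (ivar 3)) (ivar 1)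
       (for_loop 5 (iadd (INum 1) (ivar 3)) (ivar 1) update_cell)).

Definition add_pivot : program :=
  RPut isize (RBin RAdd (RGet isize)
    (RFun RLn (get_cell (isub (ivar 1) (INum 1)) (isub (ivar 1) (INum 1))))).

Definition clear_table : program :=
  for_loop 2 (INum 0) icount (IPut (atab (ivar 2)) (INum 0)).

Definition visit : program :=
  Seq (IPut (avar 1) (INum 1))
  (Seq (for_loop 2 (INum 0) isize scan_nbrs)
  (Seq (push (ivar 0))
  (Seq (for_loop 2 (INum 0) isize scan_entries)
  (Seq eliminate_matrix
  (Seq add_pivot clear_table))))).

Definition logdet_program : program :=
  Seq (for_loop 0 (INum 0) icount visit) (RPut (INum 0) (RGet isize)).

Definition table n (ks : seq 'I_n) (y : nat) : nat :=
  if y \in [seq nat_of_ord k | k <- ks]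
  then (index y [seq nat_of_ord k | k <- ks]).+1 else 0.

Lemma tableE n (ks : seq 'I_n) (a : 'I_n) :
  table ks a = if a \in ks then (index a ks).+1 else 0%N.
Proof. by rewrite /table mem_map ?index_map //; apply: val_inj. Qed.

Lemma table_gt0 n (ks : seq 'I_n) (a : 'I_n) : (0 < table ks a)%N = (a \in ks).
Proof. by rewrite tableE; case: ifP. Qed.

Lemma table_lt n (ks : seq 'I_n) (a : 'I_n) : (table ks a < (size ks).+1)%N.
Proof. by rewrite tableE; case: ifP => // aks; rewrite ltnS index_mem. Qed.

Lemma table_inj n (ks : seq 'I_n) (a b : 'I_n) :
  a \in ks -> table ks a = table ks b -> a = b.
Proof.
move=> aks; rewrite !tableE aks; case: ifP => // bks [].
exact: index_inj.
Qed.

Lemma table_rcons n (ks : seq 'I_n) (a : 'I_n) (y : nat) : a \notin ks ->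
  table (rcons ks a) y = if y == a then (size ks).+1 else table ks y.
Proof.
move=> aks; rewrite /table map_rcons mem_rcons inE -cats1 index_cat /=.
have aks' : (val a \in [seq nat_of_ord k | k <- ks]) = false.
  by rewrite (mem_map val_inj); apply: negbTE.
case: eqVneq => [->|ya] /=; first by rewrite aks' ?eqxx ?addn0 size_map.
by case: (y \in [seq nat_of_ord k | k <- ks]).
Qed.

Lemma table_ge n (ks : seq 'I_n) (y : nat) : (n <= y)%N -> table ks y = 0%N.
Proof.
move=> ny; rewrite /table ifF //; apply/mapP => -[k _ yk].
by move: ny; rewrite yk leqNgt ltn_ord.
Qed.

Definition nbrs_of (R : realType) n (num : 'S_n) (v : 'I_n) (t : 'I_n * 'I_n * R) :
    seq 'I_n :=
  (if (t.1.1 == v) && (num v < num t.1.2)%N then [:: t.1.2] else [::]) ++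
  (if (t.1.2 == v) && (num v < num t.1.1)%N then [:: t.1.1] else [::]).

Definition listed_nbrs (R : realType) n (num : 'S_n) (l : seq ('I_n * 'I_n * R))
  (v : 'I_n) : seq 'I_n := flatten [seq nbrs_of num v t | t <- l].

Lemma cell_inj (a b c d W : nat) : (b < W)%N -> (d < W)%N ->
  (a * W + b = c * W + d)%N -> a = c /\ b = d.
Proof.
move=> bW dW h; have := congr1 (divn^~ W) h; have := congr1 (modn^~ W) h.
rewrite /= !modnMDl !modn_small // !divnMDl ?divn_small ?addn0 //.
all: by case: (W) bW.
Qed.

(** * Correctness and cost of the program *)

Section Verification.
Variables (R : realType) (n : nat) (num : 'S_n) (l : seq ('I_n * 'I_n * R)).
Variables (w : nat) (Y : 'M[R]_n).

Local Notation state := (state R).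
Local Notation runs := (runs num l w).
Local Notation ival := (ival num l).
Local Notation rval := (rval num l w).
Local Notation nbrs v := (listed_nbrs num l v).

Hypothesis Ysym : Y^T = Y.
Hypothesis lY : forall t, t \in l -> t.2 = Y t.1.1 t.1.2.
Hypothesis nbrs_uniq : forall v, uniq (rcons (nbrs v) v).
Hypothesis nbrs_listed : forall v a b, a \in rcons (nbrs v) v ->
  b \in rcons (nbrs v) v ->
  ((a, b) \in [seq t.1 | t <- l]) || ((b, a) \in [seq t.1 | t <- l]).
Hypothesis nbrs_size : forall v, ((size (nbrs v)).+2 <= w)%N.

Lemma Ysym_entry a b : Y a b = Y b a.
Proof. by rewrite -[in LHS]Ysym mxE. Qed.

Definition scan_inv (v : 'I_n) (ac : R) (ks : seq 'I_n) (s : state) : Prop :=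
  [/\ vars s 0 = v, vars s 1 = (size ks).+1, (forall y, tab s y = table ks y) &
      acc s = ac].

Lemma runs_push v ac ks s a (c : 'I_n) : scan_inv v ac ks s -> ival s a c ->
  (iops a <= 30)%N -> c \notin ks ->
  runs (push a) s 200
    (fun s' => scan_inv v ac (rcons ks c) s' /\ vars s' 2 = vars s 2).
Proof.
move=> [sv sW st sa] ac_c sz cks.
apply: (@runs_seq _ _ _ _ _ _ _ _ 100 100 (fun s' => s' = set_tab s c (size ks).+1)).
  apply: (@runs_set_tab _ _ _ _ _ _ _ _ c (size ks).+1) => //.
    by rewrite -sW; apply: ival_ivar.
  by rewrite /=; lia.
move=> _ ->; apply: (@runs_set_var _ _ _ _ _ _ _ _ (size ks).+2) => //.
  rewrite -[(size ks).+2]add1n; apply: ival_add (ival_num _ _ _ _) _.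
  by rewrite -sW; apply: (@ival_ivar _ _ _ _ (set_tab s c (vars s 1)) 1).
split=> //; split=> //=; first by rewrite size_rcons.
by move=> y; rewrite table_rcons // st.
Qed.

Lemma runs_maybe_push v ac ks s a b (ra rb : 'I_n) : scan_inv v ac ks s ->
  ival s a ra -> ival s b rb -> (iops a <= 30)%N -> (iops b <= 30)%N ->
  let ks' := ks ++ (if (ra == v) && (num v < num rb)%N then [:: rb] else [::]) in
  uniq ks' ->
  runs (If (nbr_test a b) (push b) Skip) s 400
    (fun s' => scan_inv v ac ks' s' /\ vars s' 2 = vars s 2).
Proof.
move=> sI sra srb sza szb ks' ks'u; have [sv sW st sa] := sI.
have i0 : ival s (ivar 0) v by rewrite -sv; apply: ival_ivar.
have i1 : ival s (iadd (iadd (isub a (ivar 0)) (isub (ivar 0) a))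
         (isub (iadd (INum 1) (inumber (ivar 0))) (inumber b)))
   ((ra - v) + (v - ra) + ((1 + num v) - num rb)).
  apply: ival_add; first by apply: ival_add; apply: ival_sub.
  apply: ival_sub; last exact: ival_inumber.
  by apply: ival_add (ival_num _ _ _ _) _; apply: ival_inumber.
apply: (@runs_if_le _ _ _ _ _ _ _ _ _ _ _ _ 200 200 _ i1 (ival_num _ _ _ 0)).
  by rewrite /=; lia.
have -> : ((ra - v) + (v - ra) + ((1 + num v) - num rb) <= 0)%N =
    (ra == v) && (num v < num rb)%N.
  rewrite -val_eqE /=; apply/idP/idP; lia.
move: ks'u; rewrite /ks'; case: ifP => _ ks'u; last by rewrite cats0; apply: runs_skip.
rewrite cats1 in ks'u *; apply: runs_push => //.
by move: ks'u; rewrite rcons_uniq => /andP[].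
Qed.

Lemma listed_nbrs_uniq_take v k : uniq (listed_nbrs num (take k l) v).
Proof.
have : uniq (nbrs v) by have := nbrs_uniq v; rewrite rcons_uniq => /andP[].
by rewrite /listed_nbrs -{1}(cat_take_drop k l) map_cat flatten_cat cat_uniq => /and3P[].
Qed.

Lemma runs_scan_nbrs v ac s : scan_inv v ac [::] s ->
  runs (for_loop 2 (INum 0) isize scan_nbrs) s (100 + size l * 900)
    (scan_inv v ac (nbrs v)).
Proof.
move=> sI; pose Inv k := scan_inv v ac (listed_nbrs num (take k l) v).
have -> : scan_inv v ac (nbrs v) = Inv (size l) by rewrite /Inv take_size.
rewrite -[X in (X * 900)%N]subn0.
apply: (@runs_for _ _ _ _ _ _ _ _ _ 0 (size l) s 800 Inv) => //.
- by rewrite /Inv take0.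
move=> k {sI}s /andP[_ kl] sk sI.
pose t := nth (v, v, 0) l k.
have i2 : ival s (ivar 2) k by rewrite -sk; apply: ival_ivar.
have irc : ival s (irow (ivar 2)) t.1.1 by apply: ival_irow.
have icc : ival s (icol (ivar 2)) t.1.2 by apply: ival_icol.
have ksE : listed_nbrs num (take k.+1 l) v =
    (listed_nbrs num (take k l) v ++
      (if (t.1.1 == v) && (num v < num t.1.2)%N then [:: t.1.2] else [::])) ++
      (if (t.1.2 == v) && (num v < num t.1.1)%N then [:: t.1.1] else [::]).
  rewrite /listed_nbrs (take_nth (v, v, 0)) // map_rcons -cats1 flatten_cat /=.
  by rewrite cats0 /nbrs_of catA.
have u := listed_nbrs_uniq_take v k.+1; rewrite ksE in u.
have u1 := u; rewrite cat_uniq in u1; case/andP: u1 => u1 _.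
apply: (runs_seq (T := 400) (T' := 400)).
  exact: (runs_maybe_push sI irc icc).
move=> s1 [s1I s12].
have i2' : ival s1 (ivar 2) k by rewrite -sk -s12; apply: ival_ivar.
have irc' : ival s1 (irow (ivar 2)) t.1.1 by apply: ival_irow.
have icc' : ival s1 (icol (ivar 2)) t.1.2 by apply: ival_icol.
apply: (runs_weaken (leqnn _)); last exact: (runs_maybe_push s1I icc' irc').
move=> s2 [[a b c d] s22]; split; first by rewrite s22 s12.
by split=> //=; rewrite ksE.
Qed.

Section Visit.
Variables (v : 'I_n) (ac : R).
Local Notation ks := (rcons (nbrs v) v).
Local Notation W := (size ks).+1.

Lemma size_W : (W <= w)%N.
Proof. by rewrite size_rcons; apply: nbrs_size. Qed.

Lemma cell_lt i j : (i < W)%N -> (j < W)%N -> (i * W + j < w * w)%N.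
Proof. by have := size_W; nia. Qed.

Lemma ival_cell s a b i j : vars s 1 = W -> ival s a i -> ival s b j ->
  ival s (acell a b) (i * W + j).
Proof.
move=> sW ai bj; apply: ival_add bj; apply: ival_mul ai _.
by rewrite -sW; apply: ival_ivar.
Qed.

Lemma rval_cell s a b i j : vars s 1 = W -> ival s a i -> ival s b j ->
  (i < W)%N -> (j < W)%N -> rval s (get_cell a b) (mat s (i * W + j)).
Proof.
move=> sW ai bj iW jW; apply: rval_mat; first exact: ival_cell.
exact: cell_lt.
Qed.

(** The matrix is not cleared between visits, so nothing is claimed about cells not yet written. At
    the end no stale cell matters, since every pair of clique vertices is listed. *)
Definition entries_inv (k : nat) (s : state) : Prop :=
  scan_inv v ac ks s /\ forall a b, a \in ks -> b \in ks ->
    ((a, b) \in [seq t.1 | t <- take k l]) || ((b, a) \in [seq t.1 | t <- take k l]) ->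
    mat s (table ks a * W + table ks b) = Y a b.

Lemma runs_scan_entries s : scan_inv v ac ks s ->
  runs (for_loop 2 (INum 0) isize scan_entries) s (100 + size l * 900)
    (entries_inv (size l)).
Proof.
move=> sI; rewrite -[X in (X * 900)%N]subn0.
apply: (@runs_for _ _ _ _ _ _ _ _ _ 0 (size l) s 800 entries_inv) => //.
- by split=> [|a b _ _]; rewrite ?take0.
move=> k {sI}s /andP[_ kl] sk [[sv sW st sa] sM].
pose t := nth (v, v, 0) l k; pose r := t.1.1; pose c := t.1.2.
have tl : t \in l by apply: mem_nth.
have tE : t.1 = (r, c) by rewrite /r /c; case: (t.1).
have i2 : ival s (ivar 2) k by rewrite -sk; apply: ival_ivar.
have irc : ival s (irow (ivar 2)) r by apply: ival_irow.
have icc : ival s (icol (ivar 2)) c by apply: ival_icol.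
have itr : ival s (itab (irow (ivar 2))) (table ks r) by rewrite -st; apply: ival_itab.
have itc : ival s (itab (icol (ivar 2))) (table ks c) by rewrite -st; apply: ival_itab.
have -> : 800%N = (100 + 700)%N by [].
apply: (@runs_if_le _ _ _ _ _ _ _ _ _ _ _ _ 700 100 _ (ival_num _ _ _ 1) (ival_mul itr itc)).
  by [].
have -> : (1 <= table ks r * table ks c)%N = (r \in ks) && (c \in ks).
  by rewrite muln_gt0 !table_gt0.
have newE (a b : 'I_n) : ((a, b) \in [seq t.1 | t <- take k.+1 l]) =
    ((a, b) == (r, c)) || ((a, b) \in [seq t.1 | t <- take k l]).
  by rewrite (take_nth (v, v, 0)) // map_rcons mem_rcons inE -/t tE.
case: ifP => [/andP[rks cks]|rcks]; last first.
  apply: runs_skip => //; split=> //; split=> //= a b aks bks.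
  rewrite !newE => h; apply: sM => //; move: h; rewrite !xpair_eqE.
  case: eqVneq => [ar|_] /=.
    case: eqVneq => [bc|_] /=; first by rewrite -ar -bc aks bks in rcks.
    case: eqVneq => [br|_] //=.
    by case: eqVneq => [ac'|] //=; rewrite -br -ac' aks bks in rcks.
  case: eqVneq => [br|_] //=.
  by case: eqVneq => [ac'|] //=; rewrite -br -ac' aks bks in rcks.
pose s1 := set_mat s (table ks r * W + table ks c) t.2.
apply: (runs_seq (T := 300) (T' := 400) (Q1 := fun s' => s' = s1)).
  apply: (runs_set_mat (k := t.2) (ival_cell sW itr itc)) => //.
  - by apply: cell_lt; apply: table_lt.
  - exact: (@rval_entry _ _ _ _ _ _ _ _ (v, v, 0) i2 kl).
move=> _ ->.
have i2' : ival s1 (ivar 2) k by rewrite -sk; apply: (@ival_ivar _ _ _ _ s1).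
have irc' : ival s1 (irow (ivar 2)) r by apply: ival_irow.
have icc' : ival s1 (icol (ivar 2)) c by apply: ival_icol.
have itr' : ival s1 (itab (irow (ivar 2))) (table ks r).
  by rewrite -st; apply: (ival_itab irc').
have itc' : ival s1 (itab (icol (ivar 2))) (table ks c).
  by rewrite -st; apply: (ival_itab icc').
have sW1 : vars s1 1 = W by [].
apply: (runs_set_mat (k := t.2) (ival_cell sW1 itc' itr')) => //.
- by apply: cell_lt; apply: table_lt.
- exact: (@rval_entry _ _ _ _ _ _ _ _ (v, v, 0) i2' kl).
split=> //; split=> //= a b aks bks.
have same (a' b' : 'I_n) : a' \in ks -> b' \in ks ->
    (table ks a * W + table ks b == table ks a' * W + table ks b')%N ->
    a = a' /\ b = b'.
  move=> a'ks b'ks /eqP/cell_inj[||ta tb]; try exact: table_lt.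
  by split; [apply: table_inj ta | apply: table_inj tb].
case: ifP => [/same[//|//|-> ->] _|ncr]; first by rewrite lY // Ysym_entry.
case: ifP => [/same[//|//|-> ->] _|nrc]; first by rewrite lY.
rewrite !newE !xpair_eqE => h; apply: sM => //; move: h.
case: eqVneq => [ar|_] /=.
  case: eqVneq => [bc|_] /=; first by rewrite ar bc eqxx in nrc.
  case: eqVneq => [br|_] //=.
  by case: eqVneq => [ac'|] //=; rewrite br ac' eqxx in ncr.
case: eqVneq => [br|_] //=.
by case: eqVneq => [ac'|] //=; rewrite br ac' eqxx in ncr.
Qed.

Local Notation A := (local_matrix Y v (nbrs v)).

Definition matrix_inv (B : nat -> nat -> R) (s : state) : Prop :=
  scan_inv v ac ks s /\ forall i j, (0 < i < W)%N -> (0 < j < W)%N ->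
    mat s (i * W + j) = B i j.

Lemma entries_matrix s : entries_inv (size l) s -> matrix_inv A s.
Proof.
move=> [sI sM]; split=> // i j /andP[i0 iW] /andP[j0 jW].
have tab_nth k : (0 < k < W)%N -> table ks (nth v ks k.-1) = k.
  case: k => // k /=; rewrite ltnS => kW.
  by rewrite tableE mem_nth // index_uniq.
have mem_k k : (0 < k < W)%N -> nth v ks k.-1 \in ks.
  by case: k => // k /=; rewrite ltnS => kW; apply: mem_nth.
have := sM (nth v ks i.-1) (nth v ks j.-1); rewrite !tab_nth ?i0 ?j0 //; apply.
- by apply: mem_k; rewrite i0.
- by apply: mem_k; rewrite j0.
by rewrite take_size; apply: nbrs_listed; apply: mem_k; rewrite ?i0 ?j0.
Qed.

Lemma matrix_inv_ext (B B' : nat -> nat -> R) s :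
  (forall i j, (0 < i < W)%N -> (0 < j < W)%N -> B i j = B' i j) ->
  matrix_inv B s -> matrix_inv B' s.
Proof. by move=> BB [sI sB]; split=> // i j iW jW; rewrite -BB // sB. Qed.

Lemma matrix_inv_set_var (B : nat -> nat -> R) s x k : (1 < x)%N ->
  matrix_inv B s -> matrix_inv B (set_var s x k).
Proof. by case: x => // -[|x] // _ [[sv sW st sa] sB]. Qed.

(** A stage runs in place, so between its steps the memory mixes stages [p.-1] and [p]. *)
Definition row_mix (p i a b : nat) : R :=
  if (a < i)%N then elim_stage A p a b else elim_stage A p.-1 a b.

Definition cell_mix (p i j a b : nat) : R :=
  if (a < i)%N || (a == i) && (b < j)%N
  then elim_stage A p a b else elim_stage A p.-1 a b.

Lemma elim_stageE p a b : (0 < p)%N -> elim_stage A p a b =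
  if (p < a)%N && (p < b)%N
  then elim_stage A p.-1 a b
         - elim_stage A p.-1 a p * elim_stage A p.-1 p b / elim_stage A p.-1 p p
  else elim_stage A p.-1 a b.
Proof. by case: p. Qed.

Lemma runs_update_cell s p i j : (0 < p)%N -> (p < i < W)%N -> (p < j < W)%N ->
  vars s 3 = p -> vars s 4 = i -> vars s 5 = j ->
  matrix_inv (cell_mix p i j) s ->
  runs update_cell s 400 (fun s' => matrix_inv (cell_mix p i j.+1) s' /\
    vars s' = vars s).
Proof.
move=> p0 /andP[pi iW] /andP[pj jW] s3 s4 s5 [[sv sW st sa] sM].
have pW : (p < W)%N by apply: ltn_trans iW.
have i3 : ival s (ivar 3) p by rewrite -s3; apply: ival_ivar.
have i4 : ival s (ivar 4) i by rewrite -s4; apply: ival_ivar.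
have i5 : ival s (ivar 5) j by rewrite -s5; apply: ival_ivar.
apply: (runs_set_mat (ival_cell sW i4 i5)).
- exact: cell_lt.
- apply: (rval_bin _ (rval_cell sW i4 i5 iW jW)).
  apply: (rval_bin _ _ (rval_cell sW i3 i3 pW pW)).
  exact: (rval_bin _ (rval_cell sW i4 i3 iW pW) (rval_cell sW i3 i5 pW jW)).
- by [].
split=> //; split=> // a b aW bW /=.
have [i0 j0] : (0 < i)%N /\ (0 < j)%N by split; [apply: ltn_trans pi | apply: ltn_trans pj].
case: eqP => [/cell_inj[||-> ->]|ne]; try by [].
- by case/andP: bW.
(* The cells read in row or column [p] already count as stage [p], but that stage leaves them
   unchanged, so their values are those required from stage [p.-1]. *)
- rewrite !sM ?i0 ?j0 ?p0 // /cell_mix ltnn eqxx ltnn ltnS leqnn pi /= pj.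
  by rewrite !(elim_stageE _ _ p0) pi pj ltnn.
rewrite sM // /cell_mix ltnS [(b <= j)%N]leq_eqVlt.
case: (eqVneq a i) ne => [->|//] ne; case: (eqVneq b j) ne => [->|//] ne.
by case: ne.
Qed.

Lemma runs_row s p i : (0 < p)%N -> (p < i < W)%N ->
  vars s 3 = p -> vars s 4 = i -> matrix_inv (row_mix p i) s ->
  runs (for_loop 5 (iadd (INum 1) (ivar 3)) (ivar 1) update_cell) s (100 + w * 500)
    (fun s' => [/\ matrix_inv (row_mix p i.+1) s', vars s' 3 = p & vars s' 4 = i]).
Proof.
move=> p0 /andP[pi iW] s3 s4 sM.
pose Inv j (s : state) := [/\ matrix_inv (cell_mix p i j) s, vars s 3 = p & vars s 4 = i].
apply: (@runs_weaken _ _ _ _ _ _ _ (100 + (W - p.+1) * (400 + 100)) _ (Inv W)).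
- by rewrite leq_add2l leq_mul //; have := size_W; lia.
- move=> s' [s'M s'3 s'4]; split=> //; apply: matrix_inv_ext s'M => a b _ /andP[_ bW].
  by rewrite /cell_mix /row_mix bW andbT orbC -leq_eqVlt.
apply: (@runs_for _ _ _ _ _ _ _ _ _ p.+1 W s 400 Inv) => //.
- by rewrite -[p.+1]add1n; apply: ival_add (ival_num _ _ _ _) _; rewrite -s3; apply: ival_ivar.
- by apply: ltn_trans iW.
(* Starting at column [p.+1] is enough: stage [p] leaves columns up to [p] as they are. *)
- split=> //; apply: matrix_inv_set_var => //; apply: matrix_inv_ext sM => a b _ _.
  rewrite /row_mix /cell_mix; case: ltnP => //= ia; case: eqVneq => //= ->.
  by rewrite ltnS; case: leqP => // bp; rewrite (elim_stageE _ _ p0) [(p < b)%N]ltnNge bp andbF.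
- move=> j s' _ _ [[[_ s'W _ _] _] _ _]; rewrite -s'W; exact: ival_ivar.
move=> j s' /andP[pj jW] s'5 [s'M s'3 s'4].
apply: runs_weaken (leqnn _) _ (runs_update_cell p0 _ _ s'3 s'4 s'5 s'M); last first.
- by rewrite pj.
- by rewrite pi.
move=> s2 [s2M s2E]; split; first by rewrite s2E.
by split; rewrite /= ?s2E //; apply: matrix_inv_set_var.
Qed.

Lemma runs_rows s p : (0 < p < W)%N -> vars s 3 = p ->
  matrix_inv (elim_stage A p.-1) s ->
  runs (for_loop 4 (iadd (INum 1) (ivar 3)) (ivar 1)
       (for_loop 5 (iadd (INum 1) (ivar 3)) (ivar 1) update_cell)) s
    (100 + w * (200 + w * 500))
    (fun s' => matrix_inv (elim_stage A p) s' /\ vars s' 3 = p).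
Proof.
move=> /andP[p0 pW] s3 sM.
pose Inv i (s : state) := matrix_inv (row_mix p i) s /\ vars s 3 = p.
apply: (@runs_weaken _ _ _ _ _ _ _ (100 + (W - p.+1) * (100 + w * 500 + 100)) _ (Inv W)).
- by rewrite leq_add2l leq_mul //; have := size_W; lia.
- move=> s' [s'M s'3]; split=> //; apply: matrix_inv_ext s'M => a b /andP[_ aW] _.
  by rewrite /row_mix aW.
apply: (@runs_for _ _ _ _ _ _ _ _ _ p.+1 W s (100 + w * 500) Inv) => //.
- by rewrite -[p.+1]add1n; apply: ival_add (ival_num _ _ _ _) _; rewrite -s3; apply: ival_ivar.
- split=> //; apply: matrix_inv_set_var => //; apply: matrix_inv_ext sM => a b _ _.
  rewrite /row_mix ltnS; case: leqP => // ap.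
  by rewrite (elim_stageE _ _ p0) [(p < a)%N]ltnNge ap.
- move=> i s' _ _ [[[_ s'W _ _] _] _]; rewrite -s'W; exact: ival_ivar.
move=> i s' /andP[pi iW] s'4 [s'M s'3].
apply: runs_weaken (leqnn _) _ (runs_row p0 _ s'3 s'4 s'M); last by rewrite pi.
by move=> s2 [s2M s23 s24]; split=> //; split=> //; apply: matrix_inv_set_var.
Qed.

Lemma runs_eliminate_matrix s : matrix_inv A s ->
  runs eliminate_matrix s (100 + w * (200 + w * (200 + w * 500)))
    (matrix_inv (elim_stage A (size ks))).
Proof.
move=> sM; pose Inv p (s : state) := matrix_inv (elim_stage A p.-1) s.
apply: (@runs_weaken _ _ _ _ _ _ _
  (100 + (W - 1) * (100 + w * (200 + w * 500) + 100)) _ (Inv W)) => //.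
- rewrite leq_add2l leq_mul //; first by have := size_W; lia.
  by rewrite [(200 + w * (200 + _))%N](_ : _ = (100 + w * (200 + w * 500) + 100)%N) //; lia.
apply: (@runs_for _ _ _ _ _ _ _ _ _ 1 W s (100 + w * (200 + w * 500)) Inv) => //.
- move=> p s' _ _ [[_ s'W _ _] _]; rewrite -s'W; exact: ival_ivar.
move=> p s' pW s'3 s'M.
apply: runs_weaken (leqnn _) _ (runs_rows pW s'3 s'M).
by move=> s2 [s2M s23]; split=> //; apply: matrix_inv_set_var.
Qed.

Definition last_pivot : R := elim_stage A (size ks) (size ks) (size ks).

Lemma runs_add_pivot s : matrix_inv (elim_stage A (size ks)) s ->
  runs add_pivot s 200 (fun s' => [/\ vars s' 0 = v,
    forall y, tab s' y = table ks y & acc s' = ac + ln last_pivot]).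
Proof.
move=> [[sv sW st sa] sM].
have iW : ival s (isub (ivar 1) (INum 1)) (size ks).
  rewrite -[size ks](subn1 W) -sW; apply: ival_sub (ival_num _ _ _ _).
  exact: ival_ivar.
apply: (runs_set_acc (k := ac + ln last_pivot)) => //.
rewrite -sa; apply: (rval_bin RAdd (rval_acc _ _ _ _)); apply: (rval_fun RLn).
have kW : (0 < size ks < W)%N by rewrite ltnSn size_rcons.
by rewrite /last_pivot -sM //; apply: rval_cell.
Qed.

Lemma runs_clear_table s : vars s 0 = v -> (forall y, tab s y = table ks y) ->
  runs clear_table s (100 + n * 200)
    (fun s' => [/\ vars s' 0 = v, forall y, tab s' y = 0%N & acc s' = acc s]).
Proof.
move=> sv st; pose Inv k (s' : state) := [/\ vars s' 0 = v,
   forall y, tab s' y = (if (y < k)%N then 0%N else table ks y) & acc s' = acc s].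
apply: (@runs_weaken _ _ _ _ _ _ _ (100 + (n - 0) * (100 + 100)) _ (Inv n)).
- by rewrite subn0.
- move=> s' [s'v s't s'a]; split=> // y; rewrite s't; case: ltnP => // ny.
  by rewrite table_ge.
apply: (@runs_for _ _ _ _ _ _ _ _ _ 0 n s 100 Inv) => //.
move=> k s' /andP[_ kn] s'2 [s'v s't s'a].
have i2 : ival s' (ivar 2) k by rewrite -s'2; apply: ival_ivar.
apply: (runs_set_tab _ i2 kn (ival_num _ _ _ 0)) => //.
split=> //; split=> //= y; rewrite s't ltnS.
by case: ltngtP.
Qed.

Lemma runs_visit s : vars s 0 = v -> (forall y, tab s y = 0%N) -> acc s = ac ->
  runs visit s (3000 + size l * 1800 + n * 200 + w * (200 + w * (200 + w * 500)))
    (fun s' => [/\ vars s' 0 = v, forall y, tab s' y = 0%N &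
       acc s' = ac + ln last_pivot]).
Proof.
move=> sv st sa.
apply: (@runs_weaken _ _ _ _ _ _ _ (100 + ((100 + size l * 900) + (200 +
  ((100 + size l * 900) + ((100 + w * (200 + w * (200 + w * 500))) +
   (200 + (100 + n * 200)))))))%N _ _ _ _ (fun _ h => h)); first by lia.
apply: (runs_seq (Q1 := scan_inv v ac [::])).
  exact: (runs_set_var _ _ (ival_num _ _ _ 1)).
move=> s1 /runs_scan_nbrs s1r; apply: (runs_seq s1r) => s2 s2I.
apply: (runs_seq (Q1 := scan_inv v ac ks)).
  have i0 : ival s2 (ivar 0) v by case: s2I => <- _ _ _; apply: ival_ivar.
  apply: (runs_weaken (leqnn _) _ (runs_push s2I i0 _ _)) => //; first by move=> s' [].
  by have := nbrs_uniq v; rewrite rcons_uniq => /andP[].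
move=> s3 /runs_scan_entries s3r; apply: (runs_seq s3r) => s4 /entries_matrix.
move=> /runs_eliminate_matrix s4r; apply: (runs_seq s4r) => s5 /runs_add_pivot s5r.
apply: (runs_seq s5r) => s6 [s6v s6t <-].
exact: runs_clear_table.
Qed.

End Visit.

Local Notation ac k := (\sum_(v < n | (v < k)%N) ln (last_pivot v)).

Lemma runs_visits s : (forall y, tab s y = 0%N) -> acc s = 0 ->
  runs (for_loop 0 (INum 0) icount visit) s
    (100 + n * (4000 + size l * 1800 + n * 200 + w * (200 + w * (200 + w * 500))))
    (fun s' => acc s' = \sum_v ln (last_pivot v)).
Proof.
move=> st sa; pose Inv k (s : state) := (forall y, tab s y = 0%N) /\ acc s = ac k.
set T := (3000 + size l * 1800 + n * 200 + w * (200 + w * (200 + w * 500)))%N.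
apply: (@runs_weaken _ _ _ _ _ _ _ (100 + (n - 0) * (T + 100)) _ (Inv n)).
- by rewrite leq_add2l subn0 leq_mul2l /T; apply/orP; right; lia.
- by move=> s' [_ ->]; apply: eq_bigl => v; rewrite ltn_ord.
apply: (@runs_for _ _ _ _ _ _ _ _ _ 0 n s T Inv) => //.
- by split=> //=; rewrite sa big_pred0.
move=> k s' /andP[_ kn] s'0 [s't s'a].
pose v := Ordinal kn.
apply: (runs_weaken (leqnn _) _ (runs_visit (v := v) s'0 s't s'a)).
move=> s2 [s2v s2t s2a]; split=> //; split=> //=.
rewrite s2a [RHS](bigD1 v) //= addrC; congr (_ + _); apply: eq_bigl => u.
by rewrite ltnS ltn_neqAle andbC -val_eqE.
Qed.

Lemma exec_logdet_program : exists k M',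
  [/\ exec logdet_program (input_memory num l) k M',
      rmem M' 0 = \sum_v ln (last_pivot v),
      (ops k <= 200 + n * (4000 + size l * 1800 + n * 200
                 + w * (200 + w * (200 + w * 500))))%N,
      (icells k <= 8 + (n + (size l + size l)) + n)%N &
      (rcells k <= 1 + size l + w * w)%N].
Proof.
rewrite input_memoryE; set s0 := State _ _ _ _.
have [k [s [ex [kT kI kJ sa]]]] := @runs_visits s0 (fun=> erefl) erefl.
(* The result goes to real cell 0, which may hold an input value, so the last memory need not be of
   the form [mem_of] and this write is executed directly. *)
exists (cost_add k (Cost 5 2 (size l).+1)), (rput (mem_of num l s) 0 (acc s)); split.
- apply: exec_seq ex _.
  have := exec_rput (INum 0) (RGet isize) (mem_of num l s).
  have [re _ _] := rval_acc num l w s; rewrite re /=.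
  suff -> : cost_add (cost_add one_op (cost_add (cost_add one_op (access_int 1)) (access_real (size l)))) (access_real 0) = Cost 5 2 (size l).+1.
    by [].
  by rewrite /cost_add /=; congr Cost; lia.
- by rewrite /= sa.
- by rewrite /=; lia.
- by rewrite /= geq_max; move: kI; lia.
- by rewrite /= geq_max; move: kJ; lia.
Qed.

End Verification.

(** * Complexity *)

Section ListedEntries.
Variables (R : realType) (n : nat) (e : rel 'I_n) (num : 'S_n).
Hypothesis esym : symmetric e.

Local Notation F := (chordal_extension e num).
Local Notation K := (higher_nbrs e num).

Variables (X : 'M[option R]_n) (l : seq ('I_n * 'I_n * R)).
Hypothesis XF : specified_on F X.
Hypothesis lX : lists_entries X l.

Lemma nbrs_of_endpoints v w (t : 'I_n * 'I_n * R) : w \in nbrs_of num v t ->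
  [set t.1.1; t.1.2] = [set v; w]%SET /\ (num v < num w)%N.
Proof.
rewrite /nbrs_of mem_cat; case: ifP => [/andP[/eqP <- lt]|_].
  rewrite mem_seq1 => /orP[/eqP -> //|]; case: ifP => // /andP[/eqP tv].
  by rewrite tv ltnn.
rewrite in_nil /=; case: ifP => // /andP[/eqP <- lt]; rewrite mem_seq1 => /eqP ->.
by rewrite finset.setUC.
Qed.

(** A neighbour found twice would come from two entries with the same endpoint set [[set v; w]]; a
    single entry contributes at most one neighbour. *)
Lemma listed_nbrs_uniq v : uniq (listed_nbrs num l v).
Proof.
case: lX => _ + _; rewrite /listed_nbrs.
elim: l => //= t l' IHl /andP[tl' /IHl ul']; rewrite cat_uniq ul' andbT.
apply/andP; split.
  rewrite /nbrs_of; case: ifP => [/andP[/eqP <- lt]|_]; last by case: ifP.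
  by case: ifP => // /andP[/eqP tv]; rewrite tv ltnn in lt *.
apply/hasPn => w /flattenP[_ /mapP[t' t'l ->] wt']; apply: contra tl' => wt.
apply/mapP; exists t' => //.
by rewrite (proj1 (nbrs_of_endpoints wt)) (proj1 (nbrs_of_endpoints wt')).
Qed.

Lemma entry_pattern i j x : (i, j, x) \in l -> (i == j) || F i j.
Proof. by case: lX => lX1 _ _ /lX1 Xij; rewrite -XF Xij. Qed.

Lemma pattern_entry i j : (i == j) || F i j ->
  ((i, j) \in [seq t.1 | t <- l]) || ((j, i) \in [seq t.1 | t <- l]).
Proof.
rewrite -XF; case: lX => _ _ lX3; case Xij: (X i j) => [x|//] _.
by case: (lX3 _ _ _ Xij) => [h|h]; apply/orP; [left|right]; apply/mapP; eexists; eauto.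
Qed.

Lemma mem_listed_nbrs v w : (w \in listed_nbrs num l v) = (w \in K v).
Proof.
rewrite inE; apply/flattenP/andP => [[_ /mapP[t tl ->] wt]|[Fvw vw]].
  have [tE vw] := nbrs_of_endpoints wt; split=> //.
  case: t tl tE {wt} => [[i j] x] /entry_pattern /= Fij tE.
  have vNw : v != w by apply: contraTneq vw => ->; rewrite ltnn.
  have : v \in [set i; j]%SET by rewrite tE !inE eqxx.
  have : w \in [set i; j]%SET by rewrite tE !inE eqxx orbT.
  rewrite !inE => /orP[]/eqP wE /orP[]/eqP vE; move: vNw Fij; rewrite wE vE.
  - by rewrite eqxx.
  - by rewrite eq_sym => /negPf -> /=; rewrite chordal_extension_sym.
  - by move=> /negPf ->.
  - by rewrite eqxx.
have : (v == w) || F v w by rewrite Fvw orbT.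
move=> /pattern_entry/orP[]/mapP[t tl tE].
  exists (nbrs_of num v t); first exact: map_f.
  by rewrite /nbrs_of -tE /= eqxx vw mem_head.
exists (nbrs_of num v t); first exact: map_f.
by rewrite /nbrs_of -tE /= eqxx vw mem_cat mem_head orbT.
Qed.

Lemma listed_nbrs_rcons_uniq v : uniq (rcons (listed_nbrs num l v) v).
Proof.
by rewrite rcons_uniq listed_nbrs_uniq mem_listed_nbrs inE ltnn andbF.
Qed.

Lemma listed_nbrs_set v : [set w in rcons (listed_nbrs num l v) v]%SET = v |: K v.
Proof.
by apply/setP => w; rewrite inE mem_rcons finset.in_setU finset.in_set1 in_cons mem_listed_nbrs.
Qed.

Lemma size_listed_nbrs v : size (listed_nbrs num l v) = #|K v|.
Proof.
rewrite -(card_uniqP (listed_nbrs_uniq v)); apply: eq_card => w.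
exact: mem_listed_nbrs.
Qed.

Lemma listed_nbrs_clique v a b : a \in rcons (listed_nbrs num l v) v ->
  b \in rcons (listed_nbrs num l v) v ->
  ((a, b) \in [seq t.1 | t <- l]) || ((b, a) \in [seq t.1 | t <- l]).
Proof.
rewrite !mem_rcons !in_cons !mem_listed_nbrs !inE => ha hb.
apply: pattern_entry; have [//|ab /=] := eqVneq a b.
case: (eqVneq a v) ha => [av _|_ /= /andP[Fva va]].
  case: (eqVneq b v) hb => [bv _|_ /= /andP[Fvb _]]; last by rewrite av.
  by rewrite av bv eqxx in ab.
case: (eqVneq b v) hb => [-> _|_ /= /andP[Fvb vb]].
  by rewrite chordal_extension_sym.
exact: (higher_nbrs_adj (v := v)).
Qed.

(** Each entry is determined by its endpoint set, which is charged to the endpoint with the smaller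
    number; diagonal entries account for [n]. *)
Lemma size_entries : (size l <= n + \sum_v #|K v|)%N.
Proof.
pose D := [set p : 'I_n * 'I_n | p.2 \in p.1 |: K p.1]%SET.
pose f (p : 'I_n * 'I_n) : {set 'I_n} := [set p.1; p.2]%SET.
case: lX => _ lu _; rewrite -(size_map (fun t => [set t.1.1; t.1.2]%SET) l).
rewrite -(card_uniqP lu); apply: (@leq_trans #|f @: D|).
  apply/subset_leq_card/fintype.subsetP => _ /mapP[[[i j] x] tl ->].
  have [->|ij] := eqVneq i j; first by apply/imsetP; exists (j, j) => //; rewrite !inE eqxx.
  have := entry_pattern tl; rewrite (negPf ij) /= => Fij.
  have [nij|] := ltnP (num i) (num j).
    by apply/imsetP; exists (i, j) => //; rewrite !inE Fij nij orbT.
  rewrite leq_eqVlt => /orP[/eqP/val_inj/perm_inj ji|nji]; first by rewrite ji eqxx in ij.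
  apply/imsetP; exists (j, i); last by rewrite /f finset.setUC.
  by rewrite !inE chordal_extension_sym // Fij nji orbT.
apply: leq_trans (leq_imset_card _ _) _; rewrite -sum1_card.
rewrite (eq_bigl (fun p => xpredT p.1 && (p.2 \in p.1 |: K p.1))); last first.
  by move=> p; rewrite inE.
rewrite -(pair_big_dep xpredT (fun v w => w \in v |: K v) (fun _ _ => 1%N)) /=.
rewrite -[X in (X + _)%N](card_ord n) -sum1_card -big_split /=.
by apply: leq_sum => v _; rewrite sum1_card cardsU1 leq_add2r leq_b1.
Qed.

End ListedEntries.

Lemma ln_prod (R : realType) (I : finType) (s : I -> R) : (forall i, 0 < s i) ->
  \sum_i ln (s i) = ln (\prod_i s i).
Proof.
move=> s0; have [//] : 0 < \prod_i s i /\ \sum_i ln (s i) = ln (\prod_i s i).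
elim/big_ind2: _ => [|x y x' y' [x0 ->] [y0 ->]|i _]; rewrite ?ltr01 ?ln1 //.
by rewrite mulr_gt0 ?lnM.
Qed.

(** Weak but sufficient: with O(n^(3/2)) entries, one scan per vertex stays within n^(5/2). *)
Lemma ln_le_sqrt (R : realType) (x : R) : 0 < x -> ln x <= 2 * Num.sqrt x.
Proof.
move=> x0; have r0 : 0 < Num.sqrt x by rewrite sqrtr_gt0.
have -> : ln x = 2 * ln (Num.sqrt x).
  by rewrite -[in LHS](sqr_sqrtr (ltW x0)) expr2 lnM ?posrE //; lra.
rewrite ler_pM2l //; have := @le_ln1Dx R (Num.sqrt x - 1).
by rewrite [1 + _]addrC subrK => /(_ ltac:(lra)); lra.
Qed.

(** Here [x] is sqrt n, [y] the matrix width and [z] the number of entries. Per vertex, the scans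
    cost at most 1800 * 30100 * x^3 and the elimination 2 * 10^7 * x^3; with the lower terms this
    stays below 8 * 10^7 * x^3, which leaves room for the factor 10^8. *)
Lemma ops_bound_arith (R : realFieldType) (x L y z : R) :
  1 <= x -> 0 <= y -> y <= 32 * x -> L <= 2 * x ->
  z <= x * x + 10000 * (x * x) * (1 + L) ->
  200 + x * x * (4000 + z * 1800 + x * x * 200 + y * (200 + y * (200 + y * 500)))
    <= 100 * 100 * (100 * 100) * (x * x * (x * x) * x).
Proof.
move=> x1 y0 yx Lx zx.
have x0 : 0 <= x by lra.
have xx1 : 1 <= x * x by rewrite -[leLHS]mulr1 ler_pM.
have xxx : x * x <= x * x * x by rewrite -[leLHS]mulr1 ler_wpM2l //; lra.
have xx0 : 0 <= x * x by lra.
have z3 : z <= 301 * 100 * (x * x * x) by have := ler_wpM2l xx0 Lx; lra.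
have y3 : y * (200 + y * (200 + y * 500)) <= 2000 * 100 * 100 * (x * x * x).
  have b1 : 0 <= 200 + y * 500 by lra.
  have a1 : 200 + y * 500 <= 600 * x + 500 * y by lra.
  have a2 := ler_wpM2l y0 a1.
  have yy := ler_pM y0 y0 yx yx.
  have yx2 := ler_wpM2r x0 yx.
  have b2 : 0 <= 200 + y * (200 + y * 500) by have := mulr_ge0 y0 b1; lra.
  have a3 : 200 + y * (200 + y * 500) <= 5400 * 100 * (x * x) by lra.
  have := ler_pM y0 b2 yx a3; lra.
have xxx0 : 0 <= x * x * x by lra.
have s3 : 4000 + z * 1800 + x * x * 200 + y * (200 + y * (200 + y * 500))
    <= 8000 * 100 * 100 * (x * x * x) by lra.
have s4 := ler_wpM2l xx0 s3.
have xxxx : 1 <= x * x * (x * x) by rewrite -[leLHS]mulr1 ler_pM.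
have s5 : 1 <= x * x * (x * x) * x by rewrite -[leLHS]mulr1 ler_pM.
lra.
Qed.

(** * Final estimates in terms of the number of vertices *)

Section Bounds.
Variables (R : realType) (n m w : nat).
Hypothesis n0 : (0 < n)%N.
Hypothesis wr : w%:R <= 32 * Num.sqrt n%:R :> R.
Hypothesis mn : m%:R <= n%:R + 10000 * n%:R * (1 + ln n%:R) :> R.

Local Notation r := (Num.sqrt n%:R : R).

Lemma sqrt_card : r * r = n%:R.
Proof. by rewrite -expr2 sqr_sqrtr ?ler0n. Qed.

Lemma sqrt_card_ge1 : 1 <= r.
Proof. by rewrite -[X in X <= _]sqrtr1 ler_wsqrtr // ler1n. Qed.

Lemma powR52 : n%:R `^ (5 / 2) = r * r * (r * r) * r :> R.
Proof.
have -> : 5 / 2 = 2^-1 * 5%:R :> R by field.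
rewrite powRrM powR12_sqrt ?ler0n // powR_mulrn ?sqrtr_ge0 //.
by rewrite !exprS expr0; ring.
Qed.

Lemma ops_bound :
  (200 + n * (4000 + m * 1800 + n * 200 + w * (200 + w * (200 + w * 500))))%:R
    <= 100 * 100 * (100 * 100) * n%:R `^ (5 / 2) :> R.
Proof.
rewrite powR52 !(natrD, natrM).
have := @ops_bound_arith R r (ln n%:R) w%:R m%:R; rewrite !sqrt_card; apply.
- exact: sqrt_card_ge1.
- exact: ler0n.
- exact: wr.
- by apply: ln_le_sqrt; rewrite ltr0n.
- exact: mn.
Qed.

Lemma space_bound : (1 < n)%N ->
  (8 + (n + (m + m)) + n + (1 + m + w * w))%:R <= 100 * 100 * (100 * 100) * (n%:R * ln n%:R) :> R.
Proof.
move=> n1; rewrite !(natrD, natrM).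
(* From ln (1/2) <= -1/2. Terms linear in [n], among them the matrix with its [w * w] cells, are
   thereby absorbed into n ln n. *)
have lnn : 1 / 2 <= ln n%:R :> R.
  have := @le_ln1Dx R (1 / 2 - 1) ltac:(lra); rewrite addrC subrK div1r.
  rewrite lnV ?posrE // => l2; apply: (@le_trans _ _ (ln 2)); first by lra.
  by rewrite ler_ln ?posrE ?ltr0n // ler_nat.
have ww : w%:R * w%:R <= 1024 * n%:R :> R.
  rewrite -sqrt_card; have : w%:R * w%:R <= (32 * r) * (32 * r) by apply: ler_pM.
  by lra.
have nl : n%:R * (1 / 2) <= n%:R * ln n%:R :> R by apply: ler_wpM2l.
have nn : 1 <= n%:R :> R by rewrite ler1n.
move: mn; lra.
Qed.

End Bounds.

Lemma last_pivot_schur (R : realType) n (e : rel 'I_n) (num : 'S_n) (Y : 'M[R]_n)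
    (X : 'M[option R]_n) (l : seq ('I_n * 'I_n * R)) (v : 'I_n) :
  symmetric e -> specified_on (chordal_extension e num) X -> lists_entries X l ->
  posdef Y ->
  exists c, schur_pivot Y (v |: higher_nbrs e num v) v (last_pivot num l Y v) c.
Proof.
move=> esym XF lX Ypd.
have [c] := elim_schur_pivot Ypd (listed_nbrs_rcons_uniq esym XF lX v).
rewrite (listed_nbrs_set esym XF lX) => cP; exists c.
by rewrite /last_pivot size_rcons.
Qed.

(** Elimination in an arbitrary order of the clique, used only for existence: the completion has to
    be chosen before any entry list is available. *)
Lemma enum_pivot_schur (R : realType) n (e : rel 'I_n) (num : 'S_n) (Y : 'M[R]_n) v :
  posdef Y -> exists sc : R * ('I_n -> R),
  schur_pivot Y (v |: higher_nbrs e num v) v sc.1 sc.2.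
Proof.
move=> Ypd; set K := higher_nbrs e num v.
have u : uniq (rcons (enum K) v).
  by rewrite rcons_uniq mem_enum inE ltnn andbF enum_uniq.
have [c cP] := elim_schur_pivot Ypd u; eexists (_, c).
rewrite (_ : v |: K = [set w in rcons (enum K) v]%SET); first exact: cP.
apply/setP => w; rewrite [RHS]inE mem_rcons in_cons mem_enum.
by rewrite finset.in_setU finset.in_set1.
Qed.

Lemma clique_number_bound (R : realType) n (e : rel 'I_n) (num : 'S_n) (K : {set 'I_n}) :
  symmetric e -> nested_dissection e num -> is_clique (chordal_extension e num) K ->
  (#|K|%:R : R) <= 31 * Num.sqrt n%:R.
Proof.
move=> esym nd Kcl; have [->|K0] := eqVneq K finset.set0.
  by rewrite finset.cards0 mulr_ge0 ?sqrtr_ge0.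
have [v vK] := clique_sub_higher_nbrs Kcl K0.
have n0 : (0 < n)%N by case: n v {vK K0 Kcl nd esym e num K} => // -[].
have := higher_nbrs_sqrt R esym v nd; have := sqrt_card_ge1 R n0.
have : #|K|%:R <= 1 + #|higher_nbrs e num v|%:R :> R.
  rewrite -[1]/(1%:R) -natrD ler_nat; apply: leq_trans (subset_leq_card vK) _.
  by rewrite cardsU1 leq_add2r leq_b1.
lra.
Qed.

Theorem mainTheorem3 :
  exists (c : nat) (p : program),
  forall (R : realType) (n : nat) (e : rel 'I_n) (num : 'S_n),
    simple_graph e -> planar R e -> nested_dissection e num ->
    (forall K : {set 'I_n}, maximal_clique (chordal_extension e num) K ->
       (#|K|%:R : R) <= c%:R * Num.sqrt n%:R) /\
    (forall X : 'M[option R]_n,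
       partial_symmetric X -> specified_on (chordal_extension e num) X ->
       (exists Y : 'M[R]_n, pd_completion X Y) ->
       exists Xhat : 'M[R]_n, maxdet_completion X Xhat /\
       forall l : seq ('I_n * 'I_n * R), lists_entries X l ->
       exists (k : cost) (M : memory R),
         [/\ exec p (input_memory num l) k M,
             rmem M 0 = ln (\det Xhat),
             (0 < n)%N -> ((ops k)%:R : R) <= c%:R * n%:R `^ (5 / 2) &
             (1 < n)%N ->
             ((space_used num l k)%:R : R) <= c%:R * (n%:R * ln n%:R)]).
Proof.
have [c cE] : exists c : nat, forall R : realType, c%:R = 100 * 100 * (100 * 100) :> R.
  by exists (100 * 100 * (100 * 100))%N => R; rewrite !natrM.
exists c, logdet_program => R n e num [esym _] _ nd; rewrite cE; split=> [K|].
  move=> /maxsetp Kcl; apply: le_trans (clique_number_bound R esym nd Kcl) _.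
  by rewrite ler_wpM2r ?sqrtr_ge0 //; lra.
move=> X _ XF [Y XY]; have [[Ysym YX] Ypd] := XY.
have [sc scP] := choice (fun v => enum_pivot_schur e num v Ypd).
have [Xhat [Xhat_max Xhat_det]] := maxdet_completion_pivots esym Ypd scP XF XY.
exists Xhat; split=> // l lX.
pose w := (\max_v #|higher_nbrs e num v| + 2)%N.
have lY t : t \in l -> t.2 = Y t.1.1 t.1.2.
  by case: lX => lX1 _ _; case: t => [[i j] x] /lX1 /YX.
have sizeK v : ((size (listed_nbrs num l v)).+2 <= w)%N.
  by rewrite (size_listed_nbrs esym XF lX) /w addn2 !ltnS; apply: leq_bigmax.
have [k [M [ex Macc kT kI kJ]]] := exec_logdet_program Ysym lY
  (listed_nbrs_rcons_uniq esym XF lX) (listed_nbrs_clique esym XF lX) sizeK.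
have wr : (0 < n)%N -> w%:R <= 32 * Num.sqrt n%:R :> R.
  move=> n0; have r1 := sqrt_card_ge1 R n0; rewrite /w.
  have [v ->] : {v | \max_v #|higher_nbrs e num v| = #|higher_nbrs e num v|}.
    by apply: bigop.eq_bigmax; rewrite card_ord.
  by rewrite natrD; have := higher_nbrs_sqrt R esym v nd; lra.
have mn : (size l)%:R <= n%:R + 10000 * n%:R * (1 + ln n%:R) :> R.
  apply: (@le_trans _ _ (n + \sum_v #|higher_nbrs e num v|)%:R).
    by rewrite ler_nat (size_entries esym XF lX).
  by rewrite natrD lerD2l; apply: fill_n_log_n.
exists k, M; split=> //.
(* The computed pivots follow the list order and the pivots of [Xhat] the order of [enum];
   uniqueness of Schur pivots equates them. *)
- rewrite Macc Xhat_det -ln_prod; last exact: (pivot_gt0 Ypd scP).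
  apply: eq_bigr => v _; congr ln.
  have [c' c'P] := last_pivot_schur v esym XF lX Ypd.
  exact: schur_pivot_uniq Ysym c'P (scP v).
- move=> n0; apply: le_trans (ops_bound n0 (wr n0) mn).
  by rewrite ler_nat.
- move=> n1; have n0 := ltnW n1.
  apply: le_trans (space_bound n0 (wr n0) mn n1).
  rewrite ler_nat /space_used leq_add // geq_max ?kI ?kJ andbT.
    by rewrite size_input_ints; lia.
  by rewrite size_map; lia.
Qed.
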